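(* Let $T=T_n(\lambda,m)$ be a generalized Taft algebra. Let $\gamma \in \Bbbk \setminus\{0,1\}$ and let $\phi \in \Bbbk[t]$ be a nonzero polynomial of degree $d$. If $\Bbbk[t]$ is a $T$-module algebra with $g(t)=\gamma t$ and $x(t)=\phi$, then (1) $\gamma$ is a primitive $m$th root of unity, (2) $\lambda = \gamma^{d-1}$ and $\gcd(d-1, m) = 1$, and (3) $\operatorname{supp}(\phi) \subseteq \{d, d - m, d - 2m, \ldots \}$. Furthermore, the action is inner-faithful if and only if $m=n$. Conversely, if $\gamma$ and $\phi$ satisfy the conditions (1)–(3), then there is a unique $T$-module algebra structure on $\Bbbk[t]$ such that $g(t) = \gamma t$ and $x(t) = \phi$.
   Context: Throughout, $\Bbbk$ is a field of characteristic zero, and algebras are associative $\Bbbk$-algebras. For $f=\sum f_i t^i \in \Bbbk[t]$, $\operatorname{supp}(f)=\{i \mid f_i \neq 0\}$. Generalized Taft algebra: for positive integers $m,n$ with $m>1$, $m \mid n$, and $\lambda \in \Bbbk$ a primitive $m$th root of unity, $T_n(\lambda,m) = \Bbbk\langle x,g \mid g^n-1,\ x^m,\ gx-\lambda xg\rangle$. It is a Hopf algebra with $\Delta(g)=g\otimes g$, $\Delta(x)=g\otimes x + x\otimes 1$, $\epsilon(g)=1$, $\epsilon(x)=0$. A left $T$-module algebra is an algebra $A$ that is a left $T$-module with $r(1_A)=\epsilon(r)1_A$ and $r(ab)=\sum r_1(a)r_2(b)$ for $r\in T$, $a,b\in A$. A $T$-module $M$ is inner-faithful if $IM\neq 0$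 for every nonzero Hopf ideal $I$ of $T$. *)

(* Defs.v *)
From HB Require Import structures.
From mathcomp Require Import all_boot all_order all_algebra.
From mathcomp Require Import boolp.
From mathcomp Require Import monalg.

Set Implicit Arguments.
Unset Strict Implicit.
Unset Printing Implicit Defensive.

Import GRing.Theory.
Import Quotient.Exports.

Local Open Scope ring_scope.
Local Open Scope quotient_scope.

(* Tensor products over a field.  A tensor is a formal sum of pairs; two       *)
(* formal sums are identified when every bilinear map takes the same value on  *)
(* them, i.e. exactly when the universal property forces them to be equal.     *)
Section Tensor.
Context (k : fieldType) (U V : lmodType k).

Definition is_bilinear (W : lmodType k) (b : U -> V -> W) : Prop :=
  (forall v, linear (b^~ v)) /\ (forall u, linear (b u)).

Definition formal_sum (W : zmodType) (b : U -> V -> W) (s : seq (U * V)) : W :=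
  \sum_(p <- s) b p.1 p.2.

Definition tens_eq (s s' : seq (U * V)) : bool :=
  `[< forall (W : lmodType k) (b : U -> V -> W),
        is_bilinear b -> formal_sum b s = formal_sum b s' >].

Lemma tens_eq_equiv : equiv_class_of tens_eq.
Proof.
split=> [s|s s'|s1 s2 s3].
- by apply/asboolP.
- by apply/asboolP/asboolP=> h W b hb; rewrite h.
- by move=> /asboolP h1 /asboolP h2; apply/asboolP=> W b hb; rewrite h1 ?h2.
Qed.

Canonical tens_eq_canonical := EquivRelPack tens_eq_equiv.

Definition tens : Type := {eq_quot tens_eq}.
HB.instance Definition _ := Choice.on tens.
HB.instance Definition _ : EqQuotient _ tens_eq tens := EqQuotient.on tens.

(* The operations are locked so that unification does not unfold them.         *)
Fact tens_key : unit. Proof. by []. Qed.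

Definition tens_of : seq (U * V) -> tens :=
  locked_with tens_key (fun s => \pi_tens s).

(* The linear map on the tensor product induced by a bilinear map.             *)
Definition tens_elim (W : lmodType k) (b : U -> V -> W) (t : tens) : W :=
  formal_sum b (repr t).

Lemma tens_ofP s s' :
  tens_of s = tens_of s' <->
  (forall (W : lmodType k) (b : U -> V -> W),
     is_bilinear b -> formal_sum b s = formal_sum b s').
Proof.
rewrite /tens_of unlock; split; last by move=> h; apply/eqmodP/asboolP.
by move=> /eqmodP /asboolP.
Qed.

Lemma tens_reprK t : tens_of (repr t) = t.
Proof. by rewrite /tens_of unlock reprK. Qed.

Lemma tens_elimE (W : lmodType k) (b : U -> V -> W) s :
  is_bilinear b -> tens_elim b (tens_of s) = formal_sum b s.
Proof. by move=> hb; apply: (tens_ofP _ _).1 hb; apply: tens_reprK. Qed.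

Lemma formal_sum_repr (W : lmodType k) (b : U -> V -> W) s :
  is_bilinear b -> formal_sum b (repr (tens_of s)) = formal_sum b s.
Proof. exact: tens_elimE. Qed.

Definition tens_add : tens -> tens -> tens :=
  locked_with tens_key (fun t u => tens_of (repr t ++ repr u)).
Definition tens_opp : tens -> tens :=
  locked_with tens_key (fun t => tens_of [seq (- p.1, p.2) | p <- repr t]).
Definition tens_scale : k -> tens -> tens :=
  locked_with tens_key
    (fun c t => tens_of [seq (c *: p.1, p.2) | p <- repr t]).

Lemma tensW (P : tens -> Prop) : (forall s, P (tens_of s)) -> forall t, P t.
Proof. by move=> h t; rewrite -[t]tens_reprK; apply: h. Qed.

Lemma formal_sum_cat (W : zmodType) (b : U -> V -> W) s s' :
  formal_sum b (s ++ s') = formal_sum b s + formal_sum b s'.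
Proof. exact: big_cat. Qed.

Lemma bilinZl (W : lmodType k) (b : U -> V -> W) c u v :
  is_bilinear b -> b (c *: u) v = c *: b u v.
Proof.
case=> h _; have b0 : b 0 v = 0.
  by have := h v (-1) 0 0; rewrite /= scaler0 addr0 scaleN1r addNr.
by have := h v c u 0; rewrite /= !addr0 b0 addr0.
Qed.

Lemma bilinZr (W : lmodType k) (b : U -> V -> W) c u v :
  is_bilinear b -> b u (c *: v) = c *: b u v.
Proof.
case=> _ h; have b0 : b u 0 = 0.
  by have := h u (-1) 0 0; rewrite /= scaler0 addr0 scaleN1r addNr.
by have := h u c v 0; rewrite /= !addr0 b0 addr0.
Qed.

Lemma bilinDl (W : lmodType k) (b : U -> V -> W) u u' v :
  is_bilinear b -> b (u + u') v = b u v + b u' v.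
Proof. by case=> h _; have := h v 1 u u'; rewrite /= !scale1r. Qed.

Lemma bilinDr (W : lmodType k) (b : U -> V -> W) u v v' :
  is_bilinear b -> b u (v + v') = b u v + b u v'.
Proof. by case=> _ h; have := h u 1 v v'; rewrite /= !scale1r. Qed.

Lemma tens_ofD s s' : tens_add (tens_of s) (tens_of s') = tens_of (s ++ s').
Proof.
rewrite /tens_add unlock; apply/tens_ofP=> W b hb; rewrite !formal_sum_cat.
by rewrite !formal_sum_repr.
Qed.

Lemma formal_sumZ (W : lmodType k) (b : U -> V -> W) c s : is_bilinear b ->
  formal_sum b [seq (c *: p.1, p.2) | p <- s] = c *: formal_sum b s.
Proof.
move=> hb; rewrite /formal_sum big_map scaler_sumr.
by apply: eq_bigr=> p _ /=; rewrite bilinZl.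
Qed.

Lemma tens_ofZ c s :
  tens_scale c (tens_of s) = tens_of [seq (c *: p.1, p.2) | p <- s].
Proof.
rewrite /tens_scale unlock; apply/tens_ofP=> W b hb; rewrite !formal_sumZ //.
by rewrite !formal_sum_repr.
Qed.

Lemma tens_oppE t : tens_opp t = tens_scale (-1) t.
Proof.
rewrite /tens_opp /tens_scale !unlock; congr tens_of.
by apply: eq_map=> p; rewrite scaleN1r.
Qed.

Lemma tens_addA : associative tens_add.
Proof.
elim/tensW=> s; elim/tensW=> s'; elim/tensW=> s''.
by rewrite !tens_ofD catA.
Qed.

Lemma tens_addC : commutative tens_add.
Proof.
elim/tensW=> s; elim/tensW=> s'; rewrite !tens_ofD.
by apply/tens_ofP=> W b hb; rewrite !formal_sum_cat addrC.
Qed.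

Lemma tens_add0 : left_id (tens_of [::]) tens_add.
Proof. by elim/tensW=> s; rewrite tens_ofD. Qed.

Lemma tens_addN : left_inverse (tens_of [::]) tens_opp tens_add.
Proof.
elim/tensW=> s; rewrite tens_oppE tens_ofZ tens_ofD.
apply/tens_ofP=> W b hb; rewrite formal_sum_cat formal_sumZ //.
by rewrite scaleN1r addNr /formal_sum big_nil.
Qed.

HB.instance Definition _ :=
  GRing.isZmodule.Build tens tens_addA tens_addC tens_add0 tens_addN.

Lemma tens_scaleA c d t : tens_scale c (tens_scale d t) = tens_scale (c * d) t.
Proof.
elim/tensW: t=> s; rewrite !tens_ofZ; congr tens_of; rewrite -map_comp.
by apply: eq_map=> p /=; rewrite scalerA.
Qed.

Lemma tens_scale1 : left_id 1 tens_scale.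
Proof.
by elim/tensW=> s; rewrite tens_ofZ; congr tens_of; elim: s=> //= -[u v] s ->;
   rewrite scale1r.
Qed.

Lemma tens_scaleDr : right_distributive tens_scale +%R.
Proof.
move=> c; elim/tensW=> s; elim/tensW=> s'.
by rewrite /GRing.add /= !(tens_ofD, tens_ofZ) map_cat.
Qed.

Lemma tens_scaleDl t : {morph tens_scale^~ t : c d / c + d}.
Proof.
elim/tensW: t => s c d /=; rewrite /GRing.add /= !(tens_ofD, tens_ofZ).
apply/tens_ofP=> W b hb; rewrite formal_sum_cat !formal_sumZ //.
by rewrite scalerDl.
Qed.

HB.instance Definition _ := GRing.Zmodule_isLmodule.Build k tens
  tens_scaleA tens_scale1 tens_scaleDr tens_scaleDl.

End Tensor.

Arguments tens_of {k U V} s.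
Arguments tens_elim {k U V W} b t.

Notation "u ⊗ v" := (tens_of [:: (u, v)]) (at level 40, left associativity).

Section TensorTheory.
Context (k : fieldType) (U V : lmodType k).

Lemma tensD s s' : tens_of s + tens_of s' = tens_of (s ++ s') :> tens U V.
Proof. exact: tens_ofD. Qed.

Lemma tens0E : 0 = tens_of [::] :> tens U V.
Proof. by []. Qed.

Lemma tens_of_sum (s : seq (U * V)) : tens_of s = \sum_(p <- s) (p.1 ⊗ p.2).
Proof.
elim: s => [|[u v] s ih]; first by rewrite big_nil.
by rewrite big_cons -ih tensD.
Qed.

Lemma tens_bilinear : is_bilinear (fun (u : U) (v : V) => u ⊗ v).
Proof.
split=> [v c u u'|u c v v'] /=; rewrite /GRing.scale /= tens_ofZ tensD;
  apply/tens_ofP=> W b hb; rewrite /formal_sum !(big_cons, big_nil) /= !addr0.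
- by rewrite (bilinDl _ _ _ hb) (bilinZl _ _ _ hb).
- by rewrite (bilinDr _ _ _ hb) (bilinZr _ _ _ hb) (bilinZl _ _ _ hb).
Qed.

Lemma tens_elim_linear (W : lmodType k) (b : U -> V -> W) :
  is_bilinear b -> linear (tens_elim b).
Proof.
move=> hb c; elim/tensW=> s; elim/tensW=> s'.
rewrite {1}/GRing.scale /= tens_ofZ tensD !tens_elimE //.
by rewrite formal_sum_cat formal_sumZ.
Qed.

Lemma tens_elim_pure (W : lmodType k) (b : U -> V -> W) u v :
  is_bilinear b -> tens_elim b (u ⊗ v) = b u v.
Proof. by move=> hb; rewrite tens_elimE // /formal_sum big_seq1. Qed.

End TensorTheory.

Section TensorRing.
Context (k : fieldType) (A B : algType k).
Implicit Types s : seq (A * B).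

Definition tens_mul : tens A B -> tens A B -> tens A B :=
  locked_with tens_key (fun t u =>
    tens_of [seq (p.1 * q.1, p.2 * q.2) | p <- repr t, q <- repr u]).

Lemma formal_sum_mul (W : lmodType k) (b : A -> B -> W) s s' :
  formal_sum b [seq (p.1 * q.1, p.2 * q.2) | p <- s, q <- s'] =
  \sum_(p <- s) \sum_(q <- s') b (p.1 * q.1) (p.2 * q.2).
Proof. by rewrite /formal_sum big_allpairs_dep. Qed.

Lemma bilin_mull (W : lmodType k) (b : A -> B -> W) x y :
  is_bilinear b -> is_bilinear (fun u v => b (x * u) (y * v)).
Proof.
move=> hb; split=> [v c u u'|u c v v'] /=; rewrite mulrDr -scalerAr.
- by rewrite (bilinDl _ _ _ hb) (bilinZl _ _ _ hb).
- by rewrite (bilinDr _ _ _ hb) (bilinZr _ _ _ hb).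
Qed.

Lemma bilin_mulr (W : lmodType k) (b : A -> B -> W) x y :
  is_bilinear b -> is_bilinear (fun u v => b (u * x) (v * y)).
Proof.
move=> hb; split=> [v c u u'|u c v v'] /=; rewrite mulrDl -scalerAl.
- by rewrite (bilinDl _ _ _ hb) (bilinZl _ _ _ hb).
- by rewrite (bilinDr _ _ _ hb) (bilinZr _ _ _ hb).
Qed.

Lemma tens_ofM s s' :
  tens_mul (tens_of s) (tens_of s') =
  tens_of [seq (p.1 * q.1, p.2 * q.2) | p <- s, q <- s'].
Proof.
rewrite /tens_mul unlock; apply/tens_ofP=> W b hb; rewrite !formal_sum_mul.
transitivity (\sum_(p <- repr (tens_of s)) \sum_(q <- s')
                b (p.1 * q.1) (p.2 * q.2)).
  apply: eq_bigr=> p _; have hb' := bilin_mull p.1 p.2 hb.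
  rewrite -/(formal_sum (fun u v => b (p.1 * u) (p.2 * v)) s').
  by rewrite -(formal_sum_repr _ hb').
rewrite exchange_big [RHS]exchange_big; apply: eq_bigr=> q _ /=.
have hb' := bilin_mulr q.1 q.2 hb.
rewrite -/(formal_sum (fun u v => b (u * q.1) (v * q.2)) s).
by rewrite -(formal_sum_repr _ hb').
Qed.

Lemma tens_mulA : associative tens_mul.
Proof.
elim/tensW=> s; elim/tensW=> s'; elim/tensW=> s''; rewrite !tens_ofM.
apply/tens_ofP=> W b hb; rewrite !formal_sum_mul big_allpairs_dep.
apply: eq_bigr=> p _; rewrite big_allpairs_dep; apply: eq_bigr=> q _.
by apply: eq_bigr=> r _ /=; rewrite !mulrA.
Qed.

Lemma tens_mul1l : left_id (1 ⊗ 1) tens_mul.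
Proof.
elim/tensW=> s; rewrite tens_ofM; apply/tens_ofP=> W b hb.
rewrite formal_sum_mul big_seq1; apply: eq_bigr=> p _ /=.
by rewrite !mul1r.
Qed.

Lemma tens_mul1r : right_id (1 ⊗ 1) tens_mul.
Proof.
elim/tensW=> s; rewrite tens_ofM; apply/tens_ofP=> W b hb.
rewrite formal_sum_mul; apply: eq_bigr=> p _ /=.
by rewrite big_seq1 !mulr1.
Qed.

Lemma tens_mulDl : left_distributive tens_mul +%R.
Proof.
elim/tensW=> s; elim/tensW=> s'; elim/tensW=> s''; rewrite tensD !tens_ofM tensD.
apply/tens_ofP=> W b hb; rewrite formal_sum_cat !formal_sum_mul.
by rewrite big_cat.
Qed.

Lemma tens_mulDr : right_distributive tens_mul +%R.
Proof.
elim/tensW=> s; elim/tensW=> s'; elim/tensW=> s''; rewrite tensD !tens_ofM tensD.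
apply/tens_ofP=> W b hb; rewrite formal_sum_cat !formal_sum_mul.
by rewrite -big_split; apply: eq_bigr=> p _; rewrite big_cat.
Qed.

HB.instance Definition _ := GRing.Zmodule_isPzRing.Build (tens A B)
  tens_mulA tens_mul1l tens_mul1r tens_mulDl tens_mulDr.

Lemma tensM s s' : tens_of s * tens_of s' =
  tens_of [seq (p.1 * q.1, p.2 * q.2) | p <- s, q <- s'] :> tens A B.
Proof. exact: tens_ofM. Qed.

Lemma tens_pureM (a a' : A) (b b' : B) :
  (a ⊗ b) * (a' ⊗ b') = (a * a') ⊗ (b * b').
Proof. by rewrite tensM. Qed.

Lemma tens_scaleAl (c : k) (t u : tens A B) : c *: (t * u) = (c *: t) * u.
Proof.
elim/tensW: t => s; elim/tensW: u => s'; rewrite tensM /GRing.scale /=.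
rewrite !tens_ofZ tensM; apply/tens_ofP=> W b hb.
rewrite formal_sumZ // !formal_sum_mul big_map scaler_sumr.
apply: eq_bigr=> p _; rewrite scaler_sumr; apply: eq_bigr=> q _ /=.
by rewrite -scalerAl (bilinZl _ _ _ hb).
Qed.

Lemma tens_scaleAr (c : k) (t u : tens A B) : c *: (t * u) = t * (c *: u).
Proof.
elim/tensW: t => s; elim/tensW: u => s'; rewrite tensM /GRing.scale /=.
rewrite !tens_ofZ tensM; apply/tens_ofP=> W b hb.
rewrite formal_sumZ // !formal_sum_mul scaler_sumr.
apply: eq_bigr=> p _; rewrite big_map scaler_sumr; apply: eq_bigr=> q _ /=.
by rewrite -scalerAr (bilinZl _ _ _ hb).
Qed.

End TensorRing.

Section QBinomial.
Context (k : fieldType) (q : k).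

Fixpoint qbin (j i : nat) : k :=
  match j, i with
  | _, 0 => 1
  | 0, _.+1 => 0
  | j'.+1, i'.+1 => q ^+ (j' - i') * qbin j' i' + qbin j' i'.+1
  end.

Lemma qbin0 j : qbin j 0 = 1. Proof. by case: j. Qed.

Lemma qbinS j i :
  qbin j.+1 i.+1 = q ^+ (j - i) * qbin j i + qbin j i.+1.
Proof. by []. Qed.

Lemma qbin_small j i : (j < i)%N -> qbin j i = 0.
Proof.
elim: j i => [|j ih] [|i] // lt_ji.
by rewrite qbinS !ih ?mulr0 ?addr0 // ltnW.
Qed.

Lemma qbin_full j : qbin j j = 1.
Proof.
elim: j => // j ih.
by rewrite qbinS ih subnn expr0 mulr1 qbin_small ?addr0.
Qed.

Lemma qbin_absorb j i : (i <= j)%N ->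
  (1 - q ^+ i.+1) * qbin j i.+1 = (1 - q ^+ (j - i)) * qbin j i ->
  (1 - q ^+ i.+1) * qbin j.+1 i.+1 = (1 - q ^+ j.+1) * qbin j i.
Proof.
move=> le_ij h; rewrite qbinS mulrDr h mulrA -mulrDl; congr (_ * _).
rewrite mulrBl mul1r -exprD addSn (subnKC le_ij).
by rewrite addrC addrA subrK.
Qed.

Lemma qbin_step j i : (i <= j)%N ->
  (1 - q ^+ i.+1) * qbin j i.+1 = (1 - q ^+ (j - i)) * qbin j i.
Proof.
elim: j i => [|j ih] i.
  by case: i => // _; rewrite expr0 subrr mulr0 mul0r.
rewrite leq_eqVlt => /orP [/eqP->|lt_ij].
  by rewrite subnn expr0 subrr mul0r qbin_small ?mulr0.
rewrite qbin_absorb ?ih //.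
case: i lt_ij => [|i] lt_ij; first by rewrite subn0 !qbin0.
have lij : (i < j)%N by [].
have eji : (j.+1 - i.+1 = j - i)%N by rewrite subSS.
rewrite eji qbinS mulrDr mulrCA -ih ?(ltnW lij) // mulrA -mulrDl.
congr (_ * _); rewrite mulrBr mulr1 -exprD addnS (subnK (ltnW lij)).
by rewrite [RHS]addrC addrA subrK.
Qed.

Lemma qbin_prim m i : m.-primitive_root q -> (0 < i < m)%N -> qbin m i = 0.
Proof.
case: i => // i; case: m => // m hq /andP [_ lt_im].
have ne0 : 1 - q ^+ i.+1 != 0.
  rewrite subr_eq0 eq_sym -(prim_order_dvd hq); apply/negP => /dvdn_leq h.
  by have := leq_trans lt_im (h isT); rewrite ltnn.
apply: (mulfI ne0); rewrite qbin_absorb ?qbin_step //; do ?exact: ltnW.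
by rewrite (prim_expr_order hq) subrr mul0r mulr0.
Qed.

Lemma qbinomial (B : algType k) (u v : B) j : v * u = q *: (u * v) ->
  (u + v) ^+ j = \sum_(i < j.+1) qbin j i *: (u ^+ i * v ^+ (j - i)).
Proof.
move=> vu.
have vXu a : v ^+ a * u = q ^+ a *: (u * v ^+ a).
  elim: a => [|a ih]; first by rewrite !expr0 mul1r mulr1 scale1r.
  rewrite [in LHS]exprS -mulrA ih -scalerAr mulrA vu -scalerAl scalerA -mulrA.
  by rewrite -exprS -exprSr.
elim: j => [|j ih]; first by rewrite big_ord1 !expr0 mulr1 scale1r.
rewrite exprSr ih mulrDr !mulr_suml.
rewrite [RHS]big_ord_recl qbin0 expr0 mul1r scale1r subn0.
under [X in _ = _ + X]eq_bigr => i _ do rewrite lift0 qbinS subSS scalerDl.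
rewrite big_split /= addrCA; congr (_ + _).
  apply: eq_bigr => i _.
  by rewrite -scalerAl -mulrA vXu -!scalerAr scalerA mulrA -exprSr mulrC.
rewrite big_ord_recl [in RHS]big_ord_recr /= expr0 mul1r subn0 qbin0.
rewrite scale1r (qbin_small (ltnSn j)) scale0r addr0 -exprSr; congr (_ + _).
apply: eq_bigr => i _; rewrite -scalerAl -mulrA -exprSr.
by rewrite /bump /= add1n subnSK.
Qed.

Lemma qbinomial_prim (B : algType k) (u v : B) m :
  m.-primitive_root q -> v * u = q *: (u * v) ->
  (u + v) ^+ m = u ^+ m + v ^+ m.
Proof.
case: m => [/prim_order_gt0 //|m] hq vu; rewrite (qbinomial _ vu).
rewrite big_ord_recl big_ord_recr big1 ?add0r => [|i _].
  rewrite lift0 qbin0 qbin_full subn0 subnn !expr0 mul1r mulr1 !scale1r.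
  by rewrite /= add0r addrC.
by rewrite (qbin_prim hq) ?scale0r // lift0 /= ltnS.
Qed.

End QBinomial.

(* The free algebra k<x, g>: the letter false stands for x, true for g.  Its    *)
(* product is the one of the monoid algebra of words, locked only to keep      *)
(* unification from unfolding it.                                              *)
Section FreeAlgebra.
Context (k : fieldType).
Local Notation words := {malg k[{fmonom bool}]}.

Definition free2 : Type := words.
HB.instance Definition _ := GRing.Lmodule.on free2.

Fact free2_key : unit. Proof. by []. Qed.
Definition free2_mul : free2 -> free2 -> free2 :=
  locked_with free2_key (fun p q : words => p * q).

Lemma free2_mulE (p q : words) : free2_mul p q = (p * q : words).
Proof. by rewrite /free2_mul unlock. Qed.

Lemma free2_mulA : associative free2_mul.
Proof. by move=> p q r; rewrite !free2_mulE mulrA. Qed.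

Lemma free2_mul1l : left_id (1 : words) free2_mul.
Proof. by move=> p; rewrite free2_mulE mul1r. Qed.

Lemma free2_mul1r : right_id (1 : words) free2_mul.
Proof. by move=> p; rewrite free2_mulE mulr1. Qed.

Lemma free2_mulDl : left_distributive free2_mul +%R.
Proof. by move=> p q r; rewrite !free2_mulE (mulrDl (p : words)). Qed.

Lemma free2_mulDr : right_distributive free2_mul +%R.
Proof. by move=> p q r; rewrite !free2_mulE (mulrDr (p : words)). Qed.

Lemma free2_1neq0 : (1 : words) != 0 :> free2.
Proof. exact: oner_neq0. Qed.

HB.instance Definition _ := GRing.Zmodule_isNzRing.Build free2
  free2_mulA free2_mul1l free2_mul1r free2_mulDl free2_mulDr free2_1neq0.

Lemma free2M (p q : free2) : p * q = ((p : words) * (q : words) : words).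
Proof. exact: free2_mulE. Qed.

Lemma free2_scaleAl (c : k) (p q : free2) : c *: (p * q) = (c *: p : free2) * q.
Proof. by rewrite !free2M; apply: (scalerAl c (p : words) (q : words)). Qed.

HB.instance Definition _ := GRing.Lmodule_isLalgebra.Build k free2 free2_scaleAl.

Lemma free2_constC (c : k) (p : words) : c%:MP * p = p * c%:MP.
Proof.
rewrite !malgM_def fgmulUg fgmulgU; apply: eq_bigr => w _.
by rewrite mul1m mulm1 mulrC.
Qed.

Lemma free2_scaleAr (c : k) (p q : free2) : c *: (p * q) = p * (c *: q : free2).
Proof.
have e (r : words) : c *: r = c%:MP * r by rewrite mul_malgC.
rewrite !free2M; transitivity ((c%:MP : words) * ((p : words) * (q : words))).
  exact: e.
transitivity ((p : words) * ((c%:MP : words) * (q : words))); last first.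
  exact: (congr1 (fun r : words => (p : words) * r) (esym (e q))).
by rewrite mulrA free2_constC mulrA.
Qed.

HB.instance Definition _ := GRing.Lalgebra_isAlgebra.Build k free2 free2_scaleAr.

Fact free_x_key : unit. Proof. by []. Qed.
Fact free_g_key : unit. Proof. by []. Qed.
Definition free_x : free2 := locked_with free_x_key (<< fmu false >> : words).
Definition free_g : free2 := locked_with free_g_key (<< fmu true >> : words).

Section Lift.
Context (B : algType k) (bx bg : B).

Definition free_word (w : {fmonom bool}) : B :=
  \prod_(i <- (w : seq bool)) (if i then bg else bx).

Lemma free_word_mmorphism : mmorphism free_word.
Proof.
split=> [u v|]; rewrite /free_word ?fm1 ?big_nil //.
by rewrite fmM big_cat.
Qed.

HB.instance Definition _ :=
  isMultiplicative.Build {fmonom bool} B free_word free_word_mmorphism.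

(* The algebra morphism sending x to bx and g to bg.                           *)
Definition free_lift (p : free2) : B := mmap (GRing.in_alg B) free_word p.

Lemma free_lift_linear : linear free_lift.
Proof.
move=> c p q; rewrite /free_lift raddfD /= mmapZ.
by rewrite /GRing.in_alg -scalerAl mul1r.
Qed.

Lemma free_lift_monoid : monoid_morphism free_lift.
Proof.
have [h1 h2] : multiplicative (mmap (GRing.in_alg B) free_word).
  apply: commr_mmap_is_multiplicative => p u v.
  by rewrite /GRing.comm -scalerAl mul1r -scalerAr mulr1.
by split=> // p q; rewrite free2M; apply: h1.
Qed.

HB.instance Definition _ := GRing.isLinear.Build k free2 B _ free_lift
  free_lift_linear.
HB.instance Definition _ := GRing.isMonoidMorphism.Build free2 B free_lift
  free_lift_monoid.

Lemma free_lift_x : free_lift free_x = bx.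
Proof.
by rewrite ?/free_x ?/free_g unlock /free_lift mmapU /= /free_word fmU big_seq1 scale1r mul1r. Qed.

Lemma free_lift_g : free_lift free_g = bg.
Proof.
by rewrite ?/free_x ?/free_g unlock /free_lift mmapU /= /free_word fmU big_seq1 scale1r mul1r. Qed.

End Lift.

Lemma free2_ind (P : free2 -> Prop) :
  P 1 -> (forall p, P p -> P (free_x * p)) -> (forall p, P p -> P (free_g * p)) ->
  (forall c p q, P p -> P q -> P (c *: p + q)) -> forall p, P p.
Proof.
move=> P1 Px Pg PL p; have P0 : P 0.
  by have := PL (-1) 1 1 P1 P1; rewrite scaleN1r addNr.
have Pw (w : seq bool) : P (<< FMonom w >> : words).
  elim: w => [|b w ih]; first by rewrite -fmoneE; apply: P1.
  have -> : (<< FMonom (b :: w) >> : words) = << fmu b >> * << FMonom w >>.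
    rewrite [RHS]malgM_def fgmulUU mulr1; congr << _ >>.
    by apply: val_inj; rewrite /= fmM fmU.
  by rewrite -free2M; case: b; [have := Pg _ ih|have := Px _ ih];
     rewrite ?/free_x ?/free_g unlock.
rewrite (monalgE (p : words)); apply: (big_ind P) => // [q r hq hr|w _].
  by rewrite -[q]scale1r; apply: PL.
have -> : << mcoeff w (p : words) *g w >> = p@_w *: (<< w >> : words).
  by rewrite -mul_malgC malgM_def fgmulUU mul1m mulr1.
by rewrite -[_ *: _]addr0; apply: PL => //; rewrite -(fmK w); apply: Pw.
Qed.

End FreeAlgebra.

Arguments free_x {k}.
Arguments free_g {k}.

Record taft_datum (k : fieldType) := TaftDatum {
  taft_n : nat;
  taft_m : nat;
  taft_lambda : k;
  taft_n_gt0 : (0 < taft_n)%N;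
  taft_m_gt1 : (1 < taft_m)%N;
  taft_m_dvd_n : (taft_m %| taft_n)%N;
  taft_lambda_prim : taft_m.-primitive_root taft_lambda
}.

Section Taft.
Context (k : fieldType) (D : taft_datum k).
Local Notation n := (taft_n D).
Local Notation m := (taft_m D).
Local Notation lam := (taft_lambda D).

Definition taft_relations : seq (free2 k) :=
  [:: free_g ^+ n - 1; free_x ^+ m; free_g * free_x - lam *: (free_x * free_g)].

(* The two-sided ideal generated by the relations.                             *)
Definition taft_ideal (p : free2 k) : bool :=
  `[< exists s : seq (free2 k * free2 k * free2 k),
        all (fun q => q.1.2 \in taft_relations) s /\
        p = \sum_(q <- s) q.1.1 * q.1.2 * q.2 >].

Lemma taft_ideal_zmod : zmod_closed taft_ideal.
Proof.
split; first by apply/asboolP; exists [::]; rewrite big_nil.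
move=> p q /asboolP [s [hs ->]] /asboolP [s' [hs' ->]]; apply/asboolP.
exists (s ++ [seq (- r.1.1, r.1.2, r.2) | r <- s']).
rewrite all_cat hs /= all_map (eq_all (a2 := fun q => q.1.2 \in taft_relations)) //.
split=> //; rewrite big_cat big_map -sumrN; congr (_ + _).
by apply: eq_bigr => r _; rewrite !mulNr.
Qed.

HB.instance Definition _ := GRing.isZmodClosed.Build (free2 k) taft_ideal
  taft_ideal_zmod.

Lemma taft_idealMl p q : taft_ideal q -> taft_ideal (p * q).
Proof.
move=> /asboolP [s [hs ->]]; apply/asboolP.
exists [seq (p * r.1.1, r.1.2, r.2) | r <- s]; rewrite all_map; split=> //.
by rewrite big_map mulr_sumr; apply: eq_bigr => r _ /=; rewrite -!mulrA.
Qed.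

Lemma taft_idealMr p q : taft_ideal q -> taft_ideal (q * p).
Proof.
move=> /asboolP [s [hs ->]]; apply/asboolP.
exists [seq (r.1.1, r.1.2, r.2 * p) | r <- s]; rewrite all_map; split=> //.
by rewrite big_map mulr_suml; apply: eq_bigr => r _ /=; rewrite -mulrA.
Qed.

Lemma taft_idealR r : r \in taft_relations -> taft_ideal r.
Proof.
move=> hr; apply/asboolP; exists [:: (1, r, 1)]; rewrite /= hr; split=> //.
by rewrite big_seq1 mul1r mulr1.
Qed.

Definition taft_relations_hold (B : algType k) (bx bg : B) :=
  [/\ bg ^+ n = 1, bx ^+ m = 0 & bg * bx = lam *: (bx * bg)].

Lemma free_lift_ideal (B : algType k) (bx bg : B) p :
  taft_relations_hold bx bg -> taft_ideal p -> free_lift bx bg p = 0.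
Proof.
case=> hg hx hgx /asboolP [s [/allP hs ->]].
rewrite raddf_sum big_seq big1 // => r /hs; rewrite !inE => hr.
suff h : free_lift bx bg r.1.2 = 0 by rewrite /= !rmorphM /= h mulr0 mul0r.
case/or3P: hr => /eqP ->.
- by rewrite rmorphB rmorphXn rmorph1 /= free_lift_g hg subrr.
- by rewrite rmorphXn /= free_lift_x.
- by rewrite rmorphB /= linearZ !rmorphM /= free_lift_g free_lift_x hgx subrr.
Qed.

Lemma counit_relations : taft_relations_hold (0 : k^o) 1.
Proof.
have m_gt0 : (0 < m)%N by apply: ltnW (taft_m_gt1 D).
by split; rewrite ?expr1n ?expr0n ?(gtn_eqF m_gt0) // mulr0 mul0r scaler0.
Qed.

Lemma taft_ideal1 : ~~ taft_ideal 1.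
Proof.
apply/negP=> /(free_lift_ideal counit_relations)/eqP.
by rewrite rmorph1 oner_eq0.
Qed.

Definition taft : Type :=
  Quotient.quot (GRing.ZmodClosed.clone (free2 k) taft_ideal _).
HB.instance Definition _ := GRing.Zmodule.on taft.
HB.instance Definition _ := EqQuotient.on taft.

Fact taft_key : unit. Proof. by []. Qed.

Definition taft_pi : free2 k -> taft :=
  locked_with taft_key (fun p => \pi_taft p).

Lemma taft_piP p q : taft_pi p = taft_pi q <-> taft_ideal (p - q).
Proof.
rewrite /taft_pi unlock; split=> [/eqP|h].
  by rewrite -Quotient.idealrBE.
by apply/eqP; rewrite -Quotient.idealrBE.
Qed.

Lemma taft_reprK r : taft_pi (repr r) = r.
Proof. by rewrite /taft_pi unlock reprK. Qed.

Lemma taftW (P : taft -> Prop) : (forall p, P (taft_pi p)) -> forall r, P r.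
Proof. by move=> h r; rewrite -[r]taft_reprK; apply: h. Qed.

Lemma taft_pi_zmod : zmod_morphism taft_pi.
Proof. by move=> p q; rewrite /taft_pi unlock !piE. Qed.

HB.instance Definition _ := GRing.isZmodMorphism.Build (free2 k) taft taft_pi
  taft_pi_zmod.

Definition taft_mul : taft -> taft -> taft :=
  locked_with taft_key (fun r s => taft_pi (repr r * repr s)).
Definition taft_scale : k -> taft -> taft :=
  locked_with taft_key (fun c r => taft_pi (c *: repr r)).

Lemma taft_piM p q : taft_mul (taft_pi p) (taft_pi q) = taft_pi (p * q).
Proof.
rewrite /taft_mul unlock; apply/taft_piP; set p' := repr _; set q' := repr _.
have hp : taft_ideal (p' - p) by apply/taft_piP; rewrite taft_reprK.
have hq : taft_ideal (q' - q) by apply/taft_piP; rewrite taft_reprK.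
have -> : p' * q' - p * q = (p' - p) * q' + p * (q' - q).
  by rewrite mulrBl mulrBr addrA subrK.
by apply: rpredD; [apply: taft_idealMr|apply: taft_idealMl].
Qed.

Lemma taft_piZ c p : taft_scale c (taft_pi p) = taft_pi (c *: p).
Proof.
rewrite /taft_scale unlock; apply/taft_piP; rewrite -scalerBr -[_ - _]mul1r scalerAl.
by apply: taft_idealMl; apply/taft_piP; rewrite taft_reprK.
Qed.

Lemma taft_mulA : associative taft_mul.
Proof.
by elim/taftW=> p; elim/taftW=> q; elim/taftW=> r; rewrite !taft_piM mulrA.
Qed.

Lemma taft_mul1l : left_id (taft_pi 1) taft_mul.
Proof. by elim/taftW=> p; rewrite taft_piM mul1r. Qed.

Lemma taft_mul1r : right_id (taft_pi 1) taft_mul.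
Proof. by elim/taftW=> p; rewrite taft_piM mulr1. Qed.

Lemma taft_mulDl : left_distributive taft_mul +%R.
Proof.
elim/taftW=> p; elim/taftW=> q; elim/taftW=> r.
by rewrite -raddfD !taft_piM -raddfD mulrDl.
Qed.

Lemma taft_mulDr : right_distributive taft_mul +%R.
Proof.
elim/taftW=> p; elim/taftW=> q; elim/taftW=> r.
by rewrite -raddfD !taft_piM -raddfD mulrDr.
Qed.

Lemma taft_1neq0 : taft_pi 1 != 0.
Proof.
apply/eqP; rewrite -[0](raddf0 taft_pi) => /taft_piP; rewrite subr0.
exact/negP/taft_ideal1.
Qed.

HB.instance Definition _ := GRing.Zmodule_isNzRing.Build taft
  taft_mulA taft_mul1l taft_mul1r taft_mulDl taft_mulDr taft_1neq0.

Lemma taft_scaleA c d r : taft_scale c (taft_scale d r) = taft_scale (c * d) r.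
Proof. by elim/taftW: r => p; rewrite !taft_piZ scalerA. Qed.

Lemma taft_scale1 : left_id 1 taft_scale.
Proof. by elim/taftW=> p; rewrite taft_piZ scale1r. Qed.

Lemma taft_scaleDr : right_distributive taft_scale +%R.
Proof.
move=> c; elim/taftW=> p; elim/taftW=> q.
by rewrite -raddfD !taft_piZ -raddfD scalerDr.
Qed.

Lemma taft_scaleDl r : {morph taft_scale^~ r : c d / c + d}.
Proof. by elim/taftW: r => p c d /=; rewrite !taft_piZ -raddfD scalerDl. Qed.

HB.instance Definition _ := GRing.Zmodule_isLmodule.Build k taft
  taft_scaleA taft_scale1 taft_scaleDr taft_scaleDl.

Lemma taft_scaleAl (c : k) (r s : taft) : c *: (r * s) = (c *: r) * s.
Proof.
elim/taftW: r => p; elim/taftW: s => q; rewrite /GRing.scale /GRing.mul /=.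
by rewrite !(taft_piZ, taft_piM) scalerAl.
Qed.

HB.instance Definition _ := GRing.Lmodule_isLalgebra.Build k taft taft_scaleAl.

Lemma taft_scaleAr (c : k) (r s : taft) : c *: (r * s) = r * (c *: s).
Proof.
elim/taftW: r => p; elim/taftW: s => q; rewrite /GRing.scale /GRing.mul /=.
by rewrite !(taft_piZ, taft_piM) scalerAr.
Qed.

HB.instance Definition _ := GRing.Lalgebra_isAlgebra.Build k taft taft_scaleAr.

Lemma taft_pi_monoid : monoid_morphism taft_pi.
Proof. by split=> // p q; rewrite -taft_piM. Qed.

HB.instance Definition _ := GRing.isMonoidMorphism.Build (free2 k) taft taft_pi
  taft_pi_monoid.

Lemma taft_pi_scalable : scalable taft_pi.
Proof. by move=> c p; rewrite -taft_piZ. Qed.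

HB.instance Definition _ := GRing.isScalable.Build k (free2 k) taft *:%R taft_pi
  taft_pi_scalable.

Definition taft_x : taft := taft_pi free_x.
Definition taft_g : taft := taft_pi free_g.

Lemma taft_gn : taft_g ^+ n = 1.
Proof.
rewrite -rmorphXn -(rmorph1 taft_pi); apply/taft_piP/taft_idealR.
by rewrite inE eqxx.
Qed.

Lemma taft_xm : taft_x ^+ m = 0.
Proof.
rewrite -rmorphXn -(raddf0 taft_pi); apply/taft_piP; rewrite subr0.
by apply: taft_idealR; rewrite !inE eqxx orbT.
Qed.

Lemma taft_gx : taft_g * taft_x = lam *: (taft_x * taft_g).
Proof.
rewrite -!rmorphM -linearZ; apply/taft_piP/taft_idealR.
by rewrite !inE eqxx !orbT.
Qed.

Lemma taft_ind (P : taft -> Prop) :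
  P 1 -> (forall r, P r -> P (taft_x * r)) -> (forall r, P r -> P (taft_g * r)) ->
  (forall c r s, P r -> P s -> P (c *: r + s)) -> forall r, P r.
Proof.
move=> P1 Px Pg PL; elim/taftW=> p.
apply: (free2_ind (P := fun p => P (taft_pi p))) => {p} //.
- by move=> p hp; rewrite rmorphM; apply: Px.
- by move=> p hp; rewrite rmorphM; apply: Pg.
- by move=> c p q hp hq; rewrite linearP; apply: PL.
Qed.

(* The map out of T induced by the images bx, bg of the generators; it is an   *)
(* algebra morphism when bx and bg satisfy the relations.                      *)
Definition taft_lift (B : algType k) (bx bg : B) : taft -> B :=
  locked_with taft_key (fun r => free_lift bx bg (repr r)).

Section TaftLift.
Context (B : algType k) (bx bg : B) (hrel : taft_relations_hold bx bg).

Lemma taft_lift_pi p : taft_lift bx bg (taft_pi p) = free_lift bx bg p.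
Proof.
rewrite /taft_lift unlock; apply/eqP; rewrite -subr_eq0 -raddfB.
apply/eqP/(free_lift_ideal hrel).
by apply/taft_piP; rewrite taft_reprK.
Qed.

Lemma taft_lift_linear : linear (taft_lift bx bg).
Proof.
by move=> c; elim/taftW=> p; elim/taftW=> q; rewrite -linearP !taft_lift_pi linearP.
Qed.

Lemma taft_lift_monoid : monoid_morphism (taft_lift bx bg).
Proof.
split; first by rewrite -(rmorph1 taft_pi) taft_lift_pi rmorph1.
by elim/taftW=> p; elim/taftW=> q; rewrite -rmorphM !taft_lift_pi rmorphM.
Qed.

Lemma taft_lift_x : taft_lift bx bg taft_x = bx.
Proof. by rewrite taft_lift_pi free_lift_x. Qed.

Lemma taft_lift_g : taft_lift bx bg taft_g = bg.
Proof. by rewrite taft_lift_pi free_lift_g. Qed.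

End TaftLift.

Definition taft_counit : taft -> k := taft_lift (0 : k^o) (1 : k^o).

Lemma taft_counit_linear : linear_for *%R taft_counit.
Proof. exact: (taft_lift_linear counit_relations). Qed.

Lemma taft_counit_monoid : monoid_morphism taft_counit.
Proof. exact: (taft_lift_monoid counit_relations). Qed.

HB.instance Definition _ := GRing.isLinear.Build k taft k _ taft_counit
  taft_counit_linear.
HB.instance Definition _ := GRing.isMonoidMorphism.Build taft k taft_counit
  taft_counit_monoid.

Lemma taft_counit_x : taft_counit taft_x = 0.
Proof. exact: (taft_lift_x counit_relations). Qed.

Lemma taft_counit_g : taft_counit taft_g = 1.
Proof. exact: (taft_lift_g counit_relations). Qed.

End Taft.

Arguments taft_x {k D}.
Arguments taft_g {k D}.

Section TaftTensor.
Context (k : fieldType) (D : taft_datum k).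
Local Notation T := (taft D).

Lemma taft_tens_1neq0 : (1 : tens T T) != 0.
Proof.
pose b (r s : T) : k^o := taft_counit r * taft_counit s.
have hb : is_bilinear b.
  split=> [s c r r'|r c s s']; rewrite /b linearP /=.
    by rewrite mulrDl -mulrA.
  by rewrite mulrDr mulrCA.
apply/eqP=> /(congr1 (tens_elim b)); rewrite tens_elim_pure // /b !rmorph1.
rewrite mul1r tens0E tens_elimE // /formal_sum big_nil.
by apply/eqP/oner_neq0.
Qed.

HB.instance Definition _ := GRing.PzSemiRing_isNonZero.Build (tens T T)
  taft_tens_1neq0.
HB.instance Definition _ := GRing.Lmodule_isLalgebra.Build k (tens T T)
  (@tens_scaleAl k T T).
HB.instance Definition _ := GRing.Lalgebra_isAlgebra.Build k (tens T T)
  (@tens_scaleAr k T T).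

End TaftTensor.

Record hopf_alg (k : fieldType) := HopfAlg {
  hopf_sort :> algType k;
  comul : hopf_sort -> tens hopf_sort hopf_sort;
  counit : hopf_sort -> k;
  antipode : hopf_sort -> hopf_sort;
  comul_linear : linear comul;
  comul_monoid : monoid_morphism comul;
  counit_linear : linear_for *%R counit;
  counit_monoid : monoid_morphism counit;
  antipode_linear : linear antipode;
  comulA : forall r,
    tens_elim (fun r1 r2 => tens_elim (fun r11 r12 => r11 ⊗ (r12 ⊗ r2))
                              (comul r1)) (comul r) =
    tens_elim (fun r1 r2 => r1 ⊗ comul r2) (comul r);
  counitl : forall r, tens_elim (fun r1 r2 => counit r1 *: r2) (comul r) = r;
  counitr : forall r, tens_elim (fun r1 r2 => counit r2 *: r1) (comul r) = r;
  antipodel : forall r,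
    tens_elim (fun r1 r2 => antipode r1 * r2) (comul r) = counit r *: 1;
  antipoder : forall r,
    tens_elim (fun r1 r2 => r1 * antipode r2) (comul r) = counit r *: 1
}.

Section HopfModules.
Context (k : fieldType) (H : hopf_alg k).

Record is_module (M : lmodType k) (act : H -> M -> M) : Prop := {
  act_linearl : forall a, linear (act^~ a);
  act_linearr : forall r, linear (act r);
  act_one : forall a, act 1 a = a;
  act_mul : forall r s a, act (r * s) a = act r (act s a)
}.

Record module_algebra (A : algType k) (act : H -> A -> A) : Prop := {
  module_algebra_module : is_module act;
  act_unit : forall r, act r 1 = counit r *: 1;
  act_prod : forall r a b,
    act r (a * b) = tens_elim (fun r1 r2 => act r1 a * act r2 b) (comul r)
}.

Record hopf_ideal (I : H -> Prop) : Prop := {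
  hopf_ideal0 : I 0;
  hopf_idealP : forall c r s, I r -> I s -> I (c *: r + s);
  hopf_idealMl : forall r s, I s -> I (r * s);
  hopf_idealMr : forall r s, I r -> I (r * s);
  (* comul I is contained in I ⊗ H + H ⊗ I *)
  hopf_ideal_comul : forall r, I r -> exists s1 s2 : seq (H * H),
    [/\ forall p, p \in s1 -> I p.1, forall p, p \in s2 -> I p.2 &
        comul r = tens_of s1 + tens_of s2];
  hopf_ideal_counit : forall r, I r -> counit r = 0;
  hopf_ideal_antipode : forall r, I r -> I (antipode r)
}.

(* The subspace I M: finite sums of r a with r in I and a in M.                 *)
Definition ideal_act (M : lmodType k) (act : H -> M -> M) (I : H -> Prop)
    (z : M) : Prop :=
  exists s : seq (H * M),
    (forall p, p \in s -> I p.1) /\ z = \sum_(p <- s) act p.1 p.2.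

Definition inner_faithful (M : lmodType k) (act : H -> M -> M) : Prop :=
  forall I, hopf_ideal I -> (exists2 r, I r & r != 0) ->
  exists2 z, ideal_act act I z & z != 0.

End HopfModules.

(* The converse algebra, used to define the antipode as an anti-morphism.      *)
Section Converse.
Context (k : fieldType) (A : algType k).

HB.instance Definition _ := GRing.Lmodule.copy A^c A.

Lemma converse_scaleAl (c : k) (u v : A^c) : c *: (u * v) = (c *: u : A^c) * v.
Proof. exact: (@scalerAr k A c v u). Qed.
HB.instance Definition _ := GRing.Lmodule_isLalgebra.Build k A^c converse_scaleAl.

Lemma converse_scaleAr (c : k) (u v : A^c) : c *: (u * v) = u * (c *: v : A^c).
Proof. exact: (@scalerAl k A c v u). Qed.
HB.instance Definition _ := GRing.Lalgebra_isAlgebra.Build k A^c converse_scaleAr.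

Lemma converseM (u v : A) : (u : A^c) * (v : A^c) = (v * u : A).
Proof. by []. Qed.

Lemma converseX (u : A) j : (u : A^c) ^+ j = (u ^+ j : A).
Proof. by elim: j => // j ih; rewrite exprS ih exprSr. Qed.

End Converse.

Section TaftHopf.
Context (k : fieldType) (D : taft_datum k).
Local Notation T := (taft D).
Local Notation n := (taft_n D).
Local Notation m := (taft_m D).
Local Notation lam := (taft_lambda D).
Local Notation x := (@taft_x k D).
Local Notation g := (@taft_g k D).

Lemma tens_pureX (a b : T) j : (a ⊗ b) ^+ j = a ^+ j ⊗ b ^+ j.
Proof. by elim: j => [|j ih]; rewrite ?expr0 // !exprS ih tens_pureM. Qed.

Lemma tens0l (U V : lmodType k) (v : V) : (0 : U) ⊗ v = 0.
Proof.
have [h _] := @tens_bilinear k U V.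
by have := h v (-1) 0 0; rewrite /= scaler0 addr0 scaleN1r addNr.
Qed.

Lemma tens0r (U V : lmodType k) (u : U) : u ⊗ (0 : V) = 0.
Proof.
have [_ h] := @tens_bilinear k U V.
by have := h u (-1) 0 0; rewrite /= scaler0 addr0 scaleN1r addNr.
Qed.

Lemma comul_relations :
  taft_relations_hold D (g ⊗ x + x ⊗ 1 : tens T T) (g ⊗ g).
Proof.
have hb := @tens_bilinear k T T.
split.
- by rewrite tens_pureX taft_gn.
- rewrite addrC (qbinomial_prim (taft_lambda_prim D)).
    by rewrite !tens_pureX taft_xm tens0l tens0r addr0.
  by rewrite !tens_pureM mul1r mulr1 taft_gx (bilinZl _ _ _ hb).
- rewrite mulrDr mulrDl !tens_pureM mul1r mulr1 taft_gx scalerDr.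
  by rewrite (bilinZl _ _ _ hb) (bilinZr _ _ _ hb).
Qed.

Definition taft_comul : T -> tens T T :=
  taft_lift (g ⊗ x + x ⊗ 1 : tens T T) (g ⊗ g).

Lemma taft_comul_linear : linear taft_comul.
Proof. exact: taft_lift_linear comul_relations. Qed.

Lemma taft_comul_monoid : monoid_morphism taft_comul.
Proof. exact: taft_lift_monoid comul_relations. Qed.

HB.instance Definition _ := GRing.isLinear.Build k T (tens T T) _ taft_comul
  taft_comul_linear.
HB.instance Definition _ := GRing.isMonoidMorphism.Build T (tens T T) taft_comul
  taft_comul_monoid.

Lemma taft_comul_x : taft_comul x = g ⊗ x + x ⊗ 1.
Proof. exact: taft_lift_x comul_relations. Qed.

Lemma taft_comul_g : taft_comul g = g ⊗ g.
Proof. exact: taft_lift_g comul_relations. Qed.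

Lemma taft_gV : g ^+ n.-1 * g = 1.
Proof. by rewrite -exprSr prednK ?taft_gn ?taft_n_gt0. Qed.

Lemma taft_Vg : g * g ^+ n.-1 = 1.
Proof. by rewrite -exprS prednK ?taft_gn ?taft_n_gt0. Qed.

Lemma taft_xV : x * g ^+ n.-1 = lam *: (g ^+ n.-1 * x).
Proof.
rewrite -[LHS]mul1r -taft_gV -mulrA (mulrA g) taft_gx -scalerAl -scalerAr.
by rewrite -mulrA taft_Vg mulr1.
Qed.

Lemma qcomm_exp (B : algType k) (u v : B) j :
  v * u = lam *: (u * v) -> exists c, (u * v) ^+ j = c *: (u ^+ j * v ^+ j).
Proof.
move=> vu; have vXu a : v ^+ a * u = lam ^+ a *: (u * v ^+ a).
  elim: a => [|a ih]; first by rewrite !expr0 mul1r mulr1 scale1r.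
  rewrite [in LHS]exprS -mulrA ih -scalerAr mulrA vu -scalerAl scalerA -mulrA.
  by rewrite -exprS -exprSr.
elim: j => [|j [c ih]]; first by exists 1; rewrite !expr0 mulr1 scale1r.
exists (c * lam ^+ j); rewrite exprSr ih -scalerAl -mulrA (mulrA (v ^+ j)) vXu.
by rewrite -scalerAl -scalerAr scalerA -mulrA -exprSr mulrA -exprSr.
Qed.

Lemma antipode_relations :
  taft_relations_hold D (- (g ^+ n.-1 * x) : T^c) (g ^+ n.-1 : T^c).
Proof.
split.
- by rewrite converseX -exprM mulnC exprM taft_gn expr1n.
- rewrite converseX exprNn; have [c ->] := qcomm_exp m taft_xV.
  by rewrite taft_xm mulr0 scaler0 mulr0.
- rewrite !converseM mulNr mulrN -mulrA taft_xV -scalerAr.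
  by rewrite -[RHS]/(lam *: (- (g ^+ n.-1 * (g ^+ n.-1 * x)) : T)) scalerN.
Qed.

Definition taft_antipode : T -> T :=
  taft_lift (- (g ^+ n.-1 * x) : T^c) (g ^+ n.-1 : T^c).

Lemma taft_antipode_linear : linear taft_antipode.
Proof. exact: (taft_lift_linear antipode_relations). Qed.

HB.instance Definition _ := GRing.isLinear.Build k T T _ taft_antipode
  taft_antipode_linear.

Lemma taft_antipodeM r s :
  taft_antipode (r * s) = taft_antipode s * taft_antipode r.
Proof. exact: (etrans ((taft_lift_monoid antipode_relations).2 r s) (converseM _ _)). Qed.

Lemma taft_antipode1 : taft_antipode 1 = 1.
Proof. exact: (taft_lift_monoid antipode_relations).1. Qed.

Lemma taft_antipode_x : taft_antipode x = - (g ^+ n.-1 * x).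
Proof. exact: (taft_lift_x antipode_relations). Qed.

Lemma taft_antipode_g : taft_antipode g = g ^+ n.-1.
Proof. exact: (taft_lift_g antipode_relations). Qed.

Lemma tens_elimD (U V W : lmodType k) (b : U -> V -> W) s t :
  is_bilinear b -> tens_elim b (s + t) = tens_elim b s + tens_elim b t.
Proof.
by move=> /tens_elim_linear h; have := h 1 s t; rewrite !scale1r.
Qed.

Lemma tens_elimMl (W : lmodType k) (b : T -> T -> W) u v (t : tens T T) :
  is_bilinear b ->
  tens_elim b (u ⊗ v * t) = tens_elim (fun r s => b (u * r) (v * s)) t.
Proof.
move=> hb; elim/tensW: t => s; rewrite tensM !tens_elimE //; last first.
  exact: bilin_mull.
by rewrite formal_sum_mul big_seq1.
Qed.

Lemma eq_tens_elim (U V W : lmodType k) (b b' : U -> V -> W) t :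
  (forall u v, b u v = b' u v) -> tens_elim b t = tens_elim b' t.
Proof. by move=> h; apply: eq_bigr => p _. Qed.

Lemma tens_elim_comp (U V W W' : lmodType k) (f : W -> W') (b : U -> V -> W) t :
  linear f -> tens_elim (fun u v => f (b u v)) t = f (tens_elim b t).
Proof.
move=> hf; have f0 : f 0 = 0.
  by have := hf (-1) 0 0; rewrite scaler0 addr0 scaleN1r addNr.
have fD u v : f (u + v) = f u + f v by have := hf 1 u v; rewrite !scale1r.
rewrite /tens_elim /formal_sum; elim: (repr t) => [|p s ih].
  by rewrite !big_nil.
by rewrite !big_cons ih fD.
Qed.

Lemma taft_tens_ind (W : lmodType k) (b : T -> T -> W) (f : T -> W) :
  is_bilinear b -> linear f ->
  tens_elim b (taft_comul 1) = f 1 ->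
  (forall r, tens_elim b (taft_comul r) = f r ->
             tens_elim b (taft_comul (x * r)) = f (x * r)) ->
  (forall r, tens_elim b (taft_comul r) = f r ->
             tens_elim b (taft_comul (g * r)) = f (g * r)) ->
  forall r, tens_elim b (taft_comul r) = f r.
Proof.
move=> hb hf h1 hx hg; apply: taft_ind => // c r s hr hs.
by rewrite hf linearP (tens_elim_linear hb) hr hs.
Qed.

Lemma taft_counitl r :
  tens_elim (fun r1 r2 => taft_counit r1 *: r2) (taft_comul r) = r.
Proof.
have hb : is_bilinear (fun r1 r2 : T => taft_counit r1 *: r2).
  split=> [v c u u'|u c v v'] /=.
    by rewrite linearP scalerDl scalerA.
  by rewrite scalerDr !scalerA mulrC.
apply: (taft_tens_ind (f := id) hb) _ _ _ _ r => // [|r h|r h].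
- by rewrite [taft_comul 1]rmorph1 tens_elim_pure //= rmorph1 scale1r.
- rewrite [taft_comul _]rmorphM /= taft_comul_x mulrDl tens_elimD // !tens_elimMl // -[in RHS]h.
  rewrite -[RHS](tens_elim_comp _ _ (f := *%R x)); last first.
    by move=> c u v; rewrite mulrDr scalerAr.
  rewrite -[RHS]addr0; congr (_ + _).
    apply: eq_tens_elim => u v.
    by rewrite rmorphM /= taft_counit_g mul1r scalerAr.
  rewrite [LHS](eq_tens_elim (b' := fun _ _ => 0)).
    by rewrite /tens_elim /formal_sum big1.
  by move=> u v; rewrite rmorphM /= taft_counit_x mul0r scale0r.
- rewrite [taft_comul _]rmorphM /= taft_comul_g !tens_elimMl // -[in RHS]h.
  rewrite -[RHS](tens_elim_comp _ _ (f := *%R g)); last first.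
    by move=> c u v; rewrite mulrDr scalerAr.
  by apply: eq_tens_elim => u v; rewrite rmorphM /= taft_counit_g mul1r scalerAr.
Qed.

Lemma taft_counitr r :
  tens_elim (fun r1 r2 => taft_counit r2 *: r1) (taft_comul r) = r.
Proof.
have hb : is_bilinear (fun r1 r2 : T => taft_counit r2 *: r1).
  split=> [v c u u'|u c v v'] /=.
    by rewrite scalerDr !scalerA mulrC.
  by rewrite linearP scalerDl scalerA.
apply: (taft_tens_ind (f := id) hb) _ _ _ _ r => // [|r h|r h].
- by rewrite [taft_comul 1]rmorph1 tens_elim_pure //= rmorph1 scale1r.
- rewrite [taft_comul _]rmorphM /= taft_comul_x mulrDl tens_elimD // !tens_elimMl // -[in RHS]h.
  rewrite -[RHS](tens_elim_comp _ _ (f := *%R x)); last first.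
    by move=> c u v; rewrite mulrDr scalerAr.
  rewrite -[RHS]add0r; congr (_ + _); last first.
    by apply: eq_tens_elim => u v; rewrite mul1r scalerAr.
  rewrite [LHS](eq_tens_elim (b' := fun _ _ => 0)).
    by rewrite /tens_elim /formal_sum big1.
  by move=> u v; rewrite rmorphM /= taft_counit_x mul0r scale0r.
- rewrite [taft_comul _]rmorphM /= taft_comul_g !tens_elimMl // -[in RHS]h.
  rewrite -[RHS](tens_elim_comp _ _ (f := *%R g)); last first.
    by move=> c u v; rewrite mulrDr scalerAr.
  by apply: eq_tens_elim => u v; rewrite rmorphM /= taft_counit_g mul1r scalerAr.
Qed.

Lemma taft_antipodel r :
  tens_elim (fun r1 r2 => taft_antipode r1 * r2) (taft_comul r) =
  taft_counit r *: 1.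
Proof.
have hb : is_bilinear (fun r1 r2 : T => taft_antipode r1 * r2).
  split=> [v c u u'|u c v v'] /=.
    by rewrite linearP mulrDl scalerAl.
  by rewrite mulrDr scalerAr.
apply: (taft_tens_ind (f := fun r => taft_counit r *: 1) hb) _ _ _ _ r.
- by move=> c u v; rewrite linearP scalerDl scalerA.
- by rewrite !rmorph1 tens_elim_pure //= taft_antipode1 mulr1 scale1r.
- move=> r h; rewrite !rmorphM /= taft_comul_x taft_counit_x mul0r scale0r.
  rewrite mulrDl tens_elimD // !tens_elimMl // /tens_elim /formal_sum.
  rewrite -big_split big1 // => p _ /=.
  rewrite !taft_antipodeM taft_antipode_g taft_antipode_x mul1r.
  by rewrite mulrN mulNr -!mulrA subrr.
- move=> r h; rewrite !rmorphM /= taft_comul_g taft_counit_g mul1r -h.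
  rewrite !tens_elimMl //; apply: eq_tens_elim => u v.
  by rewrite taft_antipodeM taft_antipode_g -mulrA (mulrA _ g) taft_gV mul1r.
Qed.

Lemma taft_antipoder r :
  tens_elim (fun r1 r2 => r1 * taft_antipode r2) (taft_comul r) =
  taft_counit r *: 1.
Proof.
have hb : is_bilinear (fun r1 r2 : T => r1 * taft_antipode r2).
  split=> [v c u u'|u c v v'] /=.
    by rewrite mulrDl scalerAl.
  by rewrite linearP mulrDr scalerAr.
have hlr (y z : T) : linear (fun t : T => y * t * z).
  by move=> c u v; rewrite mulrDr mulrDl -scalerAr -scalerAl.
apply: (taft_tens_ind (f := fun r => taft_counit r *: 1) hb) _ _ _ _ r.
- by move=> c u v; rewrite linearP scalerDl scalerA.
- by rewrite !rmorph1 tens_elim_pure //= taft_antipode1 mulr1 scale1r.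
- move=> r h; rewrite !rmorphM /= taft_comul_x taft_counit_x mul0r scale0r.
  rewrite (mulrDl (g ⊗ x)) (tens_elimD _ _ hb) (tens_elimMl g x _ hb).
  rewrite (tens_elimMl x 1 _ hb).
  have e y z : tens_elim (fun u v => y * u * taft_antipode (z * v)) (taft_comul r)
      = y * (taft_counit r *: 1) * taft_antipode z.
    rewrite -h -(tens_elim_comp _ _ (hlr y (taft_antipode z))).
    by apply: eq_tens_elim => u v; rewrite taft_antipodeM !mulrA.
  rewrite (e g x) (e x 1) taft_antipode1 taft_antipode_x.
  rewrite -!scalerAr -!scalerAl !mulr1 mulrN mulrA taft_Vg mul1r.
  by rewrite scalerN addNr.
- move=> r h; rewrite !rmorphM /= taft_comul_g taft_counit_g mul1r.
  have e : tens_elim (fun u v => g * u * taft_antipode (g * v)) (taft_comul r)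
      = g * (taft_counit r *: 1) * taft_antipode g.
    rewrite -h -(tens_elim_comp _ _ (hlr g (taft_antipode g))).
    by apply: eq_tens_elim => u v; rewrite taft_antipodeM !mulrA.
  rewrite (tens_elimMl _ _ _ hb) e taft_antipode_g.
  by rewrite -!scalerAr -!scalerAl mulr1 taft_Vg.
Qed.

Section Coassoc.
Local Notation T3 := (tens T (tens T T)).

Let bR (u v : T) : T3 := u ⊗ taft_comul v.
Let c3 (v u1 u2 : T) : T3 := u1 ⊗ (u2 ⊗ v).
Let bL (u v : T) : T3 := tens_elim (c3 v) (taft_comul u).

Let hb2 := @tens_bilinear k T T.
Let hb3 := @tens_bilinear k T (tens T T).

Let c3_bilin v : is_bilinear (c3 v).
Proof.
split=> [w c u u'|u c w w']; rewrite /c3.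
  by rewrite (bilinDl _ _ _ hb3) (bilinZl _ _ _ hb3).
by rewrite (bilinDl _ _ _ hb2) (bilinZl _ _ _ hb2) (bilinDr _ _ _ hb3)
           (bilinZr _ _ _ hb3).
Qed.

Let c3_linear u1 u2 : linear (fun v => c3 v u1 u2).
Proof.
move=> c v v'; rewrite /c3 (bilinDr _ _ _ hb2) (bilinZr _ _ _ hb2).
by rewrite (bilinDr _ _ _ hb3) (bilinZr _ _ _ hb3).
Qed.

Let bL_bilin : is_bilinear bL.
Proof.
split=> [v c u u'|u c v v']; rewrite /bL.
  by rewrite linearP (tens_elim_linear (c3_bilin v)).
rewrite /tens_elim /formal_sum scaler_sumr -big_split; apply: eq_bigr => p _ /=.
by rewrite c3_linear.
Qed.

Let bR_bilin : is_bilinear bR.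
Proof.
split=> [v c u u'|u c v v']; rewrite /bR ?linearP.
  by rewrite (bilinDl _ _ _ hb3) (bilinZl _ _ _ hb3).
by rewrite (bilinDr _ _ _ hb3) (bilinZr _ _ _ hb3).
Qed.

Let bRM u u' v v' : bR (u * u') (v * v') = bR u v * bR u' v'.
Proof. by rewrite /bR rmorphM tens_pureM. Qed.

Let c3M u1 u2 v w1 w2 v' :
  c3 (v * v') (u1 * w1) (u2 * w2) = c3 v u1 u2 * c3 v' w1 w2.
Proof. by rewrite /c3 !tens_pureM. Qed.

Let bLM u u' v v' : bL (u * u') (v * v') = bL u v * bL u' v'.
Proof.
rewrite /bL rmorphM /=; elim/tensW: (taft_comul u) => s.
elim/tensW: (taft_comul u') => s'.
rewrite tensM !tens_elimE // formal_sum_mul /formal_sum mulr_suml.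
apply: eq_bigr => p _; rewrite mulr_sumr; apply: eq_bigr => q _.
by rewrite c3M.
Qed.

Let elim_mul (b : T -> T -> T3) a c (t : tens T T) : is_bilinear b ->
  (forall u u' v v', b (u * u') (v * v') = b u v * b u' v') ->
  tens_elim b (a ⊗ c * t) = b a c * tens_elim b t.
Proof.
move=> hb hM; rewrite tens_elimMl // -(tens_elim_comp _ _ (f := *%R (b a c))).
  by apply: eq_tens_elim => u v; rewrite hM.
by move=> d u v; rewrite mulrDr -tens_scaleAr.
Qed.

Lemma taft_comulA r :
  tens_elim (fun r1 r2 => tens_elim (fun r11 r12 => r11 ⊗ (r12 ⊗ r2))
                            (taft_comul r1)) (taft_comul r) =
  tens_elim (fun r1 r2 => r1 ⊗ taft_comul r2) (taft_comul r).
Proof.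
rewrite -/(tens_elim bL (taft_comul r)) -/(tens_elim bR (taft_comul r)).
have one : taft_comul 1 = 1 ⊗ 1 by rewrite rmorph1.
have bLg : bL g g = bR g g.
  by rewrite /bL /bR taft_comul_g tens_elim_pure.
have bLx : bL g x + bL x 1 = bR g x + bR x 1.
  rewrite /bL /bR taft_comul_g taft_comul_x tens_elimD // !tens_elim_pure //.
  by rewrite one /c3 (bilinDr _ _ _ hb3) addrA.
move: r; apply: (taft_tens_ind (f := fun r => tens_elim bR (taft_comul r)) bL_bilin).
- by move=> c u v; rewrite linearP (tens_elim_linear bR_bilin).
- by rewrite one !tens_elim_pure // /bL /bR one tens_elim_pure.
- move=> r h; rewrite !rmorphM /= taft_comul_x mulrDl !tens_elimD //.
  by rewrite !elim_mul // h -!mulrDl bLx.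
- move=> r h; rewrite !rmorphM /= taft_comul_g.
  by rewrite !elim_mul // h bLg.
Qed.

End Coassoc.

(* The generalized Taft algebra T_n(lambda, m): generators taft_g and taft_x,   *)
(* with comul x = g ⊗ x + x ⊗ 1 and comul g = g ⊗ g; the antipode, which these  *)
(* formulas force, sends g to g^-1 and x to - g^-1 x.                           *)
Definition taft_hopf : hopf_alg k :=
  HopfAlg taft_comul_linear taft_comul_monoid (@taft_counit_linear k D)
    (@taft_counit_monoid k D) taft_antipode_linear taft_comulA
    taft_counitl taft_counitr taft_antipodel taft_antipoder.

End TaftHopf.

(* Main.v *)
Require Import Defs.
From HB Require Import structures.
From mathcomp Require Import all_boot all_order all_algebra.
From mathcomp Require Import perm boolp ring.

(** Write sigma for the dilation p(t) |-> p(gamma t).  In a module algebra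
    structure on k[t] the generator g acts by the algebra map sigma and x acts
    by a (sigma, id)-skew derivation, so x is the twisted difference operator
    determined by

      (gamma - 1) t * x(p) = phi * (sigma(p) - p)

    ([act_x_difference]).  Both halves of the statement rest on this formula.
    It shows that the structure is unique, and that for an eigenvector u of
    sigma, x(u) = 0 exactly when u = 0 or the eigenvalue is 1
    ([twisted_difference_weight]).  Since g x = lambda x g, the iterates
    x^i(t^l) are eigenvectors of eigenvalue gamma^l lambda^i, hence x^i(t^l)
    vanishes if and only if gamma^l lambda^j = 1 for some j < i ([iter_eq0P]).

    Necessity of the conditions.  x^m(t) = 0 gives gamma lambda^j = 1 for some
    j, whence gamma^m = 1; comparing coefficients in g x(t) = lambda x g(t)
    gives gamma^i = lambda gamma for every i in the support of phi.  The rest is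
    arithmetic of roots of unity ([primitive_root_conditions]).

    Sufficiency.  The dilation and the twisted difference operator satisfy the
    relations of T in the algebra of linear endomorphisms of k[t]: the
    relation x^m = 0 holds on t^l because gamma^l is a power of lambda
    ([poly_relations]).

    Inner-faithfulness.  If m < n, then g^m - 1 generates a nonzero Hopf ideal,
    as g^m is central and group-like, and this ideal kills k[t] because
    gamma^m = 1.  If m = n, then k[t] need not be a faithful module, and the
    comultiplication must be used.  Let I be a Hopf ideal that kills k[t].  The
    coefficient of t^c in r(t^c) is a character chi_c of T, with chi_c(x) = 0
    and chi_c(g) = gamma^c; it vanishes on I, so I is stable under
    (id (x) chi_c) o comul, which is the endomorphism x |-> x,
    g |-> gamma^c g ([hopf_ideal_shift]).  Apply all these endomorphisms to
    r = sum_ij a_ij x^i g^j in I and let the results act on t^l with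
    gamma^l = lambda.  The polynomials x^i(t^l), i < m, are nonzero of distinct
    eigenvalues, hence independent, so each polynomial sum_j a_ij X^j, of degree
    less than m, vanishes at the m powers of gamma, and r = 0
    ([annihilating_hopf_ideal_eq0]). *)

Set Implicit Arguments.
Unset Strict Implicit.
Unset Printing Implicit Defensive.

Import GRing.Theory.
Local Open Scope ring_scope.

(** * The algebra of linear endomorphisms *)

Section LinearFunctions.
Context (k : fieldType) (U V : lmodType k) (f : U -> V).
Hypothesis hf : linear f.

Lemma linear_at0 : f 0 = 0.
Proof. by have := hf (-1) 0 0; rewrite scaler0 addr0 scaleN1r addNr. Qed.

Lemma linear_at_add a b : f (a + b) = f a + f b.
Proof. by have := hf 1 a b; rewrite !scale1r. Qed.

Lemma linear_at_scale c a : f (c *: a) = c *: f a.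
Proof. by have := hf c a 0; rewrite !addr0 linear_at0 addr0. Qed.

Lemma linear_at_sum (I : Type) (r : seq I) (F : I -> U) :
  f (\sum_(i <- r) F i) = \sum_(i <- r) f (F i).
Proof. exact: (big_morph f linear_at_add linear_at0). Qed.

End LinearFunctions.

Section Endomorphisms.
Context (k : fieldType) (A : algType k).

(** Bundled so that the endomorphisms carry an algebra structure, which makes
    them a target for algebra maps out of the Taft algebra. *)
Record endo := Endo { endo_fun :> A -> A; endo_linear : linear endo_fun }.
Arguments Endo {endo_fun}.

Lemma endoP (u v : endo) : u =1 v -> u = v.
Proof.
case: u => f hf; case: v => f' hf' /= /funext e; rewrite e in hf *.
by rewrite (Prop_irrelevance hf hf').
Qed.

HB.instance Definition _ := gen_eqMixin endo.
HB.instance Definition _ := gen_choiceMixin endo.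

Fact zero_linear : linear (fun _ : A => 0 : A).
Proof. by move=> c a b; rewrite scaler0 addr0. Qed.

Fact add_linear (u v : endo) : linear (fun a => u a + v a).
Proof. by move=> c a b; rewrite !endo_linear scalerDr addrACA. Qed.

Fact opp_linear (u : endo) : linear (fun a => - u a).
Proof. by move=> c a b; rewrite endo_linear opprD scalerN. Qed.

Fact scale_linear (e : k) (u : endo) : linear (fun a => e *: u a).
Proof. by move=> c a b; rewrite endo_linear scalerDr !scalerA mulrC. Qed.

Fact comp_linear (u v : endo) : linear (fun a => u (v a)).
Proof. by move=> c a b; rewrite !endo_linear. Qed.

Fact id_linear : linear (fun a : A => a).
Proof. by []. Qed.

Fact endo_addA : associative (fun u v => Endo (add_linear u v)).
Proof. by move=> u v w; apply: endoP => a /=; rewrite addrA. Qed.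

Fact endo_addC : commutative (fun u v => Endo (add_linear u v)).
Proof. by move=> u v; apply: endoP => a /=; rewrite addrC. Qed.

Fact endo_add0 : left_id (Endo zero_linear) (fun u v => Endo (add_linear u v)).
Proof. by move=> u; apply: endoP => a /=; rewrite add0r. Qed.

Fact endo_addN : left_inverse (Endo zero_linear) (fun u => Endo (opp_linear u))
  (fun u v => Endo (add_linear u v)).
Proof. by move=> u; apply: endoP => a /=; rewrite addNr. Qed.

HB.instance Definition _ :=
  GRing.isZmodule.Build endo endo_addA endo_addC endo_add0 endo_addN.

Fact endo_mulA : associative (fun u v => Endo (comp_linear u v)).
Proof. by move=> u v w; apply: endoP. Qed.

Fact endo_mul1l : left_id (Endo id_linear) (fun u v => Endo (comp_linear u v)).
Proof. by move=> u; apply: endoP. Qed.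

Fact endo_mul1r : right_id (Endo id_linear) (fun u v => Endo (comp_linear u v)).
Proof. by move=> u; apply: endoP. Qed.

Fact endo_mulDl : left_distributive (fun u v => Endo (comp_linear u v)) +%R.
Proof. by move=> u v w; apply: endoP. Qed.

Fact endo_mulDr : right_distributive (fun u v => Endo (comp_linear u v)) +%R.
Proof. by move=> u v w; apply: endoP => a; apply: linear_at_add (endo_linear u) _ _. Qed.

Fact endo_1neq0 : Endo id_linear != 0.
Proof. by apply/eqP => /(congr1 (fun u : endo => u 1))/eqP; rewrite oner_eq0. Qed.

HB.instance Definition _ := GRing.Zmodule_isNzRing.Build endo
  endo_mulA endo_mul1l endo_mul1r endo_mulDl endo_mulDr endo_1neq0.

Fact endo_scaleA c e u :
  Endo (scale_linear c (Endo (scale_linear e u))) = Endo (scale_linear (c * e) u).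
Proof. by apply: endoP => a /=; rewrite scalerA. Qed.

Fact endo_scale1 : left_id 1 (fun c u => Endo (scale_linear c u)).
Proof. by move=> u; apply: endoP => a /=; rewrite scale1r. Qed.

Fact endo_scaleDr :
  right_distributive (fun c u => Endo (scale_linear c u)) +%R.
Proof. by move=> c u v; apply: endoP => a /=; rewrite scalerDr. Qed.

Fact endo_scaleDl u : {morph (fun c => Endo (scale_linear c u)) : c e / c + e}.
Proof. by move=> c e; apply: endoP => a /=; rewrite scalerDl. Qed.

HB.instance Definition _ := GRing.Zmodule_isLmodule.Build k endo
  endo_scaleA endo_scale1 endo_scaleDr endo_scaleDl.

Fact endo_scaleAl (c : k) (u v : endo) : c *: (u * v) = (c *: u) * v.
Proof. exact: endoP. Qed.

HB.instance Definition _ := GRing.Lmodule_isLalgebra.Build k endo endo_scaleAl.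

Fact endo_scaleAr (c : k) (u v : endo) : c *: (u * v) = u * (c *: v).
Proof. by apply: endoP => a /=; rewrite (linear_at_scale (endo_linear u)). Qed.

HB.instance Definition _ := GRing.Lalgebra_isAlgebra.Build k endo endo_scaleAr.

Lemma endoX (u : endo) j a : (u ^+ j) a = iter j u a.
Proof. by elim: j a => [|j ih] a //; rewrite exprS -[LHS]/(u ((u ^+ j) a)) ih. Qed.

End Endomorphisms.

(** * Dilations and twisted difference operators on polynomials *)

Section TwistedDifference.
Context (k : fieldType) (gam : k).

Definition dilate (p : {poly k}) : {poly k} := p \Po (gam *: 'X).

Lemma dilateM p q : dilate (p * q) = dilate p * dilate q.
Proof. exact: comp_polyM. Qed.

Lemma dilateX : dilate 'X = gam *: 'X.
Proof. exact: comp_polyX. Qed.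

Lemma dilateC c : dilate c%:P = c%:P.
Proof. exact: comp_polyC. Qed.

Lemma dilate_linear : linear dilate.
Proof. by move=> c p q; rewrite /dilate comp_polyD comp_polyZ. Qed.

HB.instance Definition _ := GRing.isLinear.Build k {poly k} {poly k} _ dilate
  dilate_linear.

Lemma coef_dilate p i : (dilate p)`_i = gam ^+ i * p`_i.
Proof.
elim/poly_ind: p i => [|p c ih] i; first by rewrite linear0 coef0 mulr0.
rewrite linearD /= dilateM dilateX dilateC -scalerAr !coefD coefZ.
rewrite !coefMX !coefC.
by case: i => [|i] /=; rewrite ?mulr0 ?mul1r // !addr0 ih mulrA -exprS.
Qed.

Lemma coef_iter_dilate j p i : (iter j dilate p)`_i = gam ^+ (j * i) * p`_i.
Proof.
elim: j => [|j ih]; first by rewrite mul0n expr0 mul1r.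
by rewrite iterS coef_dilate ih mulrA -exprD mulSn.
Qed.

Lemma dilate_Xn l : dilate 'X^l = gam ^+ l *: 'X^l.
Proof.
apply/polyP => i; rewrite coef_dilate coefZ coefXn.
by case: eqP => [->|_] //; rewrite !mulr0.
Qed.

(** The dilation is diagonal in the basis of the t^i, with entries gam^i. *)
Lemma weight_coef mu u i :
  dilate u = mu *: u -> u`_i != 0 -> gam ^+ i = mu.
Proof.
move=> /(congr1 (fun p : {poly k} => p`_i)); rewrite coef_dilate coefZ.
by move=> e ui; apply: (mulIf ui).
Qed.

Context (gam_neq1 : gam != 1) (phi : {poly k}).

(** The quotient (sigma p - p) / (sigma t - t) times phi, with the denominator
    cleared. *)
Definition twisted_difference (D : {poly k} -> {poly k}) :=
  forall p, ((gam - 1)%:P * 'X) * D p = phi * (dilate p - p).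

Lemma denom_neq0 : (gam - 1)%:P * 'X != 0 :> {poly k}.
Proof. by rewrite mulf_neq0 ?polyX_eq0 // polyC_eq0 subr_eq0. Qed.

Lemma twisted_difference_inj D D' :
  twisted_difference D -> twisted_difference D' -> D =1 D'.
Proof. by move=> h h' p; apply: (mulfI denom_neq0); rewrite h h'. Qed.

(** By induction on the degree: the skew Leibniz rule computes D on p * t from
    D p and D t. *)
Lemma skew_derivation_difference D :
  D 'X = phi -> linear D ->
  D 1 = 0 -> (forall p q, D (p * q) = dilate p * D q + D p * q) ->
  twisted_difference D.
Proof.
move=> DX Dlin D1 DM; elim/poly_ind => [|p c ih].
  by rewrite (linear_at0 Dlin) linear0 subr0 !mulr0.
have -> : D (p * 'X + c%:P) = dilate p * phi + D p * 'X.
  by rewrite -alg_polyC addrC Dlin D1 scaler0 add0r DM DX.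
rewrite linearD /= dilateM dilateX dilateC mulrDr [X in _ + X]mulrA ih.
rewrite polyCB -mul_polyC; ring.
Qed.

(** For an eigenvector u the defining formula reads
    (gam - 1) t * D u = (mu - 1) phi u, and k[t] is a domain. *)
Lemma twisted_difference_weight D mu u : twisted_difference D ->
  phi != 0 -> dilate u = mu *: u -> (D u == 0) = (mu == 1) || (u == 0).
Proof.
move=> hD phi0 hu; rewrite -[LHS](mulrI_eq0 _ (mulfI denom_neq0)) hD hu.
rewrite -[X in _ - X]scale1r -scalerBl mulf_eq0 (negPf phi0) scaler_eq0.
by rewrite subr_eq0.
Qed.

Section Iterates.
Context (D : {poly k} -> {poly k}) (lam : k).
Hypotheses (hD : twisted_difference D) (phi_neq0 : phi != 0).
Hypotheses (DZ : forall c p, D (c *: p) = c *: D p).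
Hypothesis (dilateD : forall p, dilate (D p) = lam *: D (dilate p)).

Lemma iter_weight l i :
  dilate (iter i D 'X^l) = (gam ^+ l * lam ^+ i) *: iter i D 'X^l.
Proof.
elim: i => [|i ih]; first by rewrite mulr1 dilate_Xn.
by rewrite iterS dilateD ih DZ scalerA mulrCA -exprS.
Qed.

(** The eigenvalue of the j-th iterate is gam^l lam^j, and the next iterate
    vanishes exactly when this is 1; so the chain of iterates from 'X^l stops at
    the first j at which gam^l lam^j = 1. *)
Lemma iter_eq0P l i :
  iter i D 'X^l = 0 <-> exists2 j, (j < i)%N & gam ^+ l * lam ^+ j = 1.
Proof.
elim: i => [|i ih].
  by split=> [/eqP|[]//]; rewrite /= -size_poly_eq0 size_polyXn.
have e := twisted_difference_weight hD phi_neq0 (iter_weight l i).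
split=> [/eqP|].
  rewrite iterS e => /orP[/eqP h|/eqP/ih[j lt_ji h]]; first by exists i.
  by exists j => //; apply: leqW.
case=> j; rewrite ltnS leq_eqVlt => /orP[/eqP->|lt_ji] h;
  apply/eqP; rewrite iterS e.
  by rewrite h eqxx.
by apply/orP; right; apply/eqP/ih; exists j.
Qed.

End Iterates.

(** The Euclidean quotient is exact: sigma p and p have the same constant
    term.  All identities below then follow by clearing the denominator. *)
Definition twisted_diff (p : {poly k}) : {poly k} :=
  phi * ((dilate p - p) %/ ((gam - 1)%:P * 'X)).

Lemma twisted_diffP : twisted_difference twisted_diff.
Proof.
move=> p; rewrite /twisted_diff mulrCA; congr (_ * _); rewrite mulrC.
rewrite divpK // mul_polyC dvdpZl ?subr_eq0 //.
rewrite -['X]subr0 -polyC0 dvdp_XsubCl /root horner_coef0 coefB coef_dilate.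
by rewrite mul1r subrr.
Qed.

Lemma twisted_diff_linear : linear twisted_diff.
Proof.
move=> c p q; apply: (mulfI denom_neq0).
rewrite mulrDr -scalerAr !twisted_diffP linearP /= -!mul_polyC; ring.
Qed.

Lemma twisted_diffM p q :
  twisted_diff (p * q) = dilate p * twisted_diff q + twisted_diff p * q.
Proof.
apply: (mulfI denom_neq0).
rewrite mulrDr [X in _ = X + _]mulrCA [X in _ = _ + X]mulrA.
rewrite !twisted_diffP dilateM; ring.
Qed.

Lemma twisted_diff1 : twisted_diff 1 = 0.
Proof.
apply: (mulfI denom_neq0).
by rewrite twisted_diffP -polyC1 dilateC subrr !mulr0.
Qed.

Lemma twisted_diffX : twisted_diff 'X = phi.
Proof.
apply: (mulfI denom_neq0).
rewrite twisted_diffP dilateX -mul_polyC polyCB; ring.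
Qed.

Lemma dilate_twisted_diff lam : gam != 0 ->
  dilate phi = (lam * gam) *: phi ->
  forall p, dilate (twisted_diff p) = lam *: twisted_diff (dilate p).
Proof.
move=> gam0 hphi p.
have gP0 : gam%:P != 0 :> {poly k} by rewrite polyC_eq0.
apply: (mulfI (mulf_neq0 gP0 denom_neq0)).
have := congr1 dilate (twisted_diffP p).
rewrite !dilateM dilateC dilateX hphi linearB /= -mul_polyC.
rewrite [X in X * _ = _](_ : _ = gam%:P * ((gam - 1)%:P * 'X)); last by ring.
move=> ->; rewrite -scalerAr -[X in _ = _ *: X]mulrA twisted_diffP.
rewrite -!mul_polyC polyCM; ring.
Qed.

End TwistedDifference.

(** * The monomial spanning set and the Hopf ideal of g^m - 1 *)

Section TaftAlgebra.
Context (k : fieldType) (D : taft_datum k).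
Local Notation T := (taft D).
Local Notation n := (taft_n D).
Local Notation m := (taft_m D).
Local Notation lam := (taft_lambda D).
Local Notation x := (@taft_x k D).
Local Notation g := (@taft_g k D).

Lemma taft_gXx a : g ^+ a * x = lam ^+ a *: (x * g ^+ a).
Proof.
elim: a => [|a ih]; first by rewrite !expr0 mul1r mulr1 scale1r.
rewrite [in LHS]exprS -mulrA ih -scalerAr mulrA taft_gx -scalerAl scalerA -mulrA.
by rewrite -exprS -exprSr.
Qed.

Lemma taft_span (r : T) : exists c : 'M[k]_(m, n),
  r = \sum_i \sum_j c i j *: (x ^+ i * g ^+ j).
Proof.
pose Q (r : T) := exists c : 'M[k]_(m, n),
  r = \sum_i \sum_j c i j *: (x ^+ i * g ^+ j).
have QL c u v : Q u -> Q v -> Q (c *: u + v).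
  move=> [a ->] [b ->]; exists (c *: a + b).
  rewrite scaler_sumr -big_split; apply: eq_bigr => i _ /=.
  rewrite scaler_sumr -big_split; apply: eq_bigr => j _ /=.
  by rewrite !mxE scalerDl scalerA.
have Q0 : Q 0.
  exists 0; rewrite big1 // => i _; rewrite big1 // => j _.
  by rewrite mxE scale0r.
have Qb i j : Q (x ^+ i * g ^+ j).
  have [lt_im|le_mi] := ltnP i m; last first.
    by rewrite -(subnK le_mi) exprD taft_xm mulr0 mul0r; apply: Q0.
  have lt_jn : (j %% n < n)%N by rewrite ltn_mod taft_n_gt0.
  have -> : g ^+ j = g ^+ (j %% n) by rewrite expr_mod ?taft_gn.
  exists (delta_mx (Ordinal lt_im) (Ordinal lt_jn)).
  rewrite (bigD1 (Ordinal lt_im)) //= [X in _ + X]big1 ?addr0 => [|i' ne].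
    rewrite (bigD1 (Ordinal lt_jn)) //= [X in _ + X]big1 ?addr0 => [|j' ne].
      by rewrite mxE !eqxx scale1r.
    by rewrite mxE (negPf ne) andbF scale0r.
  by rewrite big1 // => j' _; rewrite mxE (negPf ne) scale0r.
(* The induction builds r by left multiplication; carrying an arbitrary monomial
   on the left of r lets that monomial absorb the generators. *)
suff h : forall i j, Q (x ^+ i * g ^+ j * r).
  by have := h 0 0; rewrite !expr0 !mul1r.
elim/taft_ind: r => [|r ih|r ih|c r s hr hs] i j.
- by rewrite mulr1; apply: Qb.
- rewrite mulrA -(mulrA _ _ x) taft_gXx -scalerAr mulrA -exprSr -scalerAl.
  by rewrite -[_ *: _]addr0; apply: QL.
- by rewrite mulrA -(mulrA _ _ g) -exprSr.
- by rewrite mulrDr -scalerAr; apply: QL.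
Qed.

(** Moving g^m past x costs lam^m = 1. *)
Lemma taft_gm_central (r : T) : g ^+ m * r = r * g ^+ m.
Proof.
elim/taft_ind: r => [|r ih|r ih|c r s hr hs]; first by rewrite mulr1 mul1r.
- rewrite mulrA taft_gXx (prim_expr_order (taft_lambda_prim D)) scale1r.
  by rewrite -mulrA ih mulrA.
- by rewrite mulrA -exprSr exprS -mulrA ih mulrA.
- by rewrite mulrDr mulrDl -scalerAr -scalerAl hr hs.
Qed.

(** As g^m is central, the right multiples of g^m - 1 already form the
    two-sided ideal. *)
Definition gm_ideal (r : taft_hopf D) : Prop := exists s : T, r = (g ^+ m - 1) * s.

(** Because g^m is group-like,
    comul (g^m - 1) = (g^m - 1) (x) g^m + 1 (x) (g^m - 1), and
    antipode (g^m - 1) = - g^-m (g^m - 1). *)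
Lemma gm_ideal_hopf : hopf_ideal gm_ideal.
Proof.
have cen (r : T) : (g ^+ m - 1) * r = r * (g ^+ m - 1).
  by rewrite mulrBl mulrBr taft_gm_central mul1r mulr1.
split.
- by exists 0; rewrite mulr0.
- by move=> c _ _ [s ->] [s' ->]; exists (c *: s + s'); rewrite mulrDr scalerAr.
- by move=> r _ [s ->]; exists (r * s); rewrite mulrA -cen mulrA.
- by move=> _ r [s ->]; exists (s * r); rewrite mulrA.
- move=> _ [s ->]; have -> : comul ((g ^+ m - 1) * s : taft_hopf D)
      = (((g ^+ m - 1) ⊗ g ^+ m) + (1 ⊗ (g ^+ m - 1))) * taft_comul s.
    rewrite -[LHS]/(taft_comul _) rmorphM rmorphB rmorphXn rmorph1 /=.
    rewrite taft_comul_g tens_pureX; congr (_ * _).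
    have hb := @tens_bilinear k T T.
    rewrite -[- 1]scaleN1r (bilinDl _ _ _ hb) (bilinZl _ _ _ hb).
    rewrite (bilinDr _ _ _ hb) (bilinZr _ _ _ hb) !scaleN1r.
    by rewrite addrA subrK.
  rewrite mulrDl -(tens_reprK (taft_comul s)) !tensM.
  set s0 := repr _; eexists; eexists; split; last by []; move=> p.
    case/allpairsP => -[u v] [/= hu hv ->] /=.
    by move: hu; rewrite inE => /eqP -> /=; eexists.
  case/allpairsP => -[u v] [/= hu hv ->] /=.
  by move: hu; rewrite inE => /eqP -> /=; eexists.
- move=> _ [s ->]; rewrite -[LHS]/(taft_counit _) rmorphM rmorphB rmorphXn /=.
  by rewrite rmorph1 taft_counit_g expr1n subrr mul0r.
- move=> _ [s ->]; rewrite -[antipode _]/(taft_antipode _) taft_antipodeM.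
  have -> : taft_antipode (g ^+ m - 1) = - (taft_antipode g ^+ m) * (g ^+ m - 1).
    rewrite linearB /= taft_antipode1.
    have -> : taft_antipode (g ^+ m) = taft_antipode g ^+ m.
      elim: (m) => [|j ih]; first by rewrite !expr0 taft_antipode1.
      by rewrite exprSr taft_antipodeM ih exprS.
    rewrite taft_antipode_g mulrBr mulr1 mulNr opprK.
    rewrite -exprMn_comm ?taft_gV ?expr1n 1?addrC //.
    by rewrite /GRing.comm taft_gV taft_Vg.
  by eexists; rewrite mulrA cen.
Qed.

(** T maps onto the group algebra of Z/n by killing x; here g goes to the
    permutation matrix of an n-cycle, which has order n over every field. *)
Lemma taft_gm_neq1 : m != n -> g ^+ m != 1.
Proof.
move=> ne; have lt_mn : (m < n)%N.
  by rewrite ltn_neqAle ne dvdn_leq ?taft_m_dvd_n ?taft_n_gt0.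
have n1 := prednK (taft_n_gt0 D).
pose s := perm (@ordS_inj n.-1.+1); pose B := 'M[k]_n.-1.+1.
have sE j (i : 'I_n.-1.+1) : ((s ^+ j)%g i : nat) = ((i + j) %% n)%N.
  elim: j => [|j ih].
    by rewrite expg0 perm1 addn0 modn_small // -[X in (_ < X)%N]n1.
  rewrite expgSr permM permE /= ih [X in (_ %% X)%N = _]n1.
  by rewrite -addn1 modnDml addn1 addnS.
have pX j : (perm_mx s : B) ^+ j = perm_mx (s ^+ j)%g.
  elim: j => [|j ih]; first by rewrite expr0 expg0 perm_mx1.
  by rewrite exprS expgS perm_mxM ih.
have hrel : taft_relations_hold D (0 : B) (perm_mx s).
  split.
  - rewrite pX; have -> : (s ^+ n)%g = 1%g; last by rewrite perm_mx1.
    apply/permP => i; rewrite perm1.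
    apply: val_inj; rewrite /= sE modnDr modn_small //.
    by rewrite -[X in (_ < X)%N]n1.
  - by rewrite expr0n gtn_eqF // (ltnW (taft_m_gt1 D)).
  - by rewrite mul0r mulr0 scaler0.
apply/eqP => /(congr1 (taft_lift (0 : B) (perm_mx s))).
have [h1 hM] := taft_lift_monoid hrel.
have hX j : taft_lift (0 : B) (perm_mx s) (g ^+ j) = perm_mx s ^+ j.
  elim: j => [|j ih]; first by rewrite !expr0.
  by rewrite exprS hM ih (taft_lift_g hrel) -exprS.
rewrite hX h1 pX => /matrixP /(_ ord0 ord0).
rewrite !mxE eqxx -val_eqE /= sE add0n modn_small //.
by rewrite gtn_eqF ?(ltnW (taft_m_gt1 D)) // => /eqP; rewrite eq_sym oner_eq0.
Qed.

End TaftAlgebra.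

(** * The generators in a module algebra *)

Section Actions.
Context (k : fieldType) (D : taft_datum k).
Local Notation T := (taft D).
Local Notation H := (taft_hopf D).
Local Notation n := (taft_n D).
Local Notation m := (taft_m D).
Local Notation lam := (taft_lambda D).
Local Notation x := (@taft_x k D).
Local Notation g := (@taft_g k D).

Lemma act_tens_bilinear (A : algType k) (act : H -> A -> A) a b :
  is_module act -> is_bilinear (fun r1 r2 : T => act r1 a * act r2 b).
Proof.
move=> hact; split=> [v c u u'|u c v v'] /=.
  by rewrite (act_linearl hact) mulrDl scalerAl.
by rewrite (act_linearl hact) mulrDr scalerAr.
Qed.

Lemma act_g_prod (A : algType k) (act : H -> A -> A) a b :
  module_algebra act -> act g (a * b) = act g a * act g b.
Proof.
move=> h; have hb := act_tens_bilinear a b (module_algebra_module h).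
rewrite (act_prod h) -[comul _]/(taft_comul _) taft_comul_g.
exact: tens_elim_pure.
Qed.

Lemma act_x_prod (A : algType k) (act : H -> A -> A) a b :
  module_algebra act -> act x (a * b) = act g a * act x b + act x a * b.
Proof.
move=> h; have hb := act_tens_bilinear a b (module_algebra_module h).
rewrite (act_prod h) -[comul _]/(taft_comul _) taft_comul_x.
rewrite tens_elimD // (tens_elim_pure _ _ hb) (tens_elim_pure _ _ hb).
by rewrite (act_one (module_algebra_module h)).
Qed.

Lemma act_exp (M : lmodType k) (act : H -> M -> M) (r : T) i a :
  is_module act -> act (r ^+ i) a = iter i (act r) a.
Proof.
move=> h; elim: i a => [|i ih] a; first by rewrite expr0 (act_one h).
by rewrite exprS (act_mul h) ih.
Qed.

Lemma act_ext (M : lmodType k) (act act' : H -> M -> M) :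
  is_module act -> is_module act' ->
  act x =1 act' x -> act g =1 act' g -> forall r, act r =1 act' r.
Proof.
move=> h h' hx hg; elim/taft_ind => [|r ih|r ih|c r s hr hs] a.
- by rewrite (act_one h) (act_one h').
- by rewrite (act_mul h) (act_mul h') ih hx.
- by rewrite (act_mul h) (act_mul h') ih hg.
- by rewrite (act_linearl h) (act_linearl h') hr hs.
Qed.

Section PolyAction.
Context (act : H -> {poly k} -> {poly k}) (hact : module_algebra act).
Context (gam : k) (phi : {poly k}).
Hypotheses (act_gX : act g 'X = gam *: 'X) (act_xX : act x 'X = phi).
Let hmod := module_algebra_module hact.

(** g is group-like, so it acts by algebra endomorphisms. *)
Lemma act_gE p : act g p = dilate gam p.
Proof.
have lg := act_linearr hmod g.
have g1 : act g 1 = 1.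
  by rewrite (act_unit hact) -[counit _]/(taft_counit _) taft_counit_g scale1r.
elim/poly_ind: p => [|p c ih].
  by rewrite (linear_at0 lg) linear0.
rewrite addrC -alg_polyC lg g1 act_g_prod // ih act_gX.
by rewrite linearD /= dilateM dilateX alg_polyC dilateC.
Qed.

Lemma act_x1 : act x 1 = 0.
Proof.
by rewrite (act_unit hact) -[counit _]/(taft_counit _) taft_counit_x scale0r.
Qed.

Lemma act_x_difference : twisted_difference gam phi (act x).
Proof.
apply: skew_derivation_difference; rewrite ?act_x1 //.
  exact: act_linearr hmod x.
by move=> p q; rewrite act_x_prod // act_gE.
Qed.

Lemma act_gx p : dilate gam (act x p) = lam *: act x (dilate gam p).
Proof.
rewrite -!act_gE -!(act_mul hmod) -[act _ _]/(act (g * x : T) p) taft_gx.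
by rewrite (linear_at_scale (act_linearl hmod p)).
Qed.

End PolyAction.
End Actions.

(** * Necessity of the conditions *)

(** lam lies in the group generated by gam, because gam^d = lam gam, so the
    order of gam is a multiple of m as well as a divisor of it.  Then lam is the
    power of gam of exponent d - 1, and it is primitive exactly when this
    exponent is prime to m. *)
Lemma primitive_root_conditions (k : fieldType) (gam lam : k) m d :
  gam != 0 -> m.-primitive_root lam -> gam ^+ m = 1 ->
  gam ^+ d = lam * gam ->
  [/\ m.-primitive_root gam, lam = gam ^ (d%:Z - 1) & gcdz (d%:Z - 1) m%:Z = 1].
Proof.
move=> gam0 lamP gm gd; have m_gt0 := prim_order_gt0 lamP.
have gamP : m.-primitive_root gam.
  have [r rP r_dvd] := prim_order_exists m_gt0 gm.
  suff m_dvd : (m %| r)%N.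
    by have /eqP <- : r == m by rewrite eqn_dvd r_dvd.
  rewrite (prim_order_dvd lamP); apply/eqP.
  have := congr1 (fun z => z ^+ r) gd.
  by rewrite exprMn exprAC (prim_expr_order rP) expr1n mulr1 => <-.
split=> //.
  by apply: (mulIf gam0); rewrite -gd expfzDr // -mulrA exprN1 mulVf // mulr1.
(* The exponent d - 1 is negative when d = 0; d + m.-1 represents it modulo m. *)
have co : coprime (d + m.-1) m.
  rewrite -(prim_root_exp_coprime _ gamP).
  have <- // : lam = gam ^+ (d + m.-1).
  by apply: (mulIf gam0); rewrite -gd exprD -mulrA -exprSr prednK // gm mulr1.
have e : d%:Z - 1 = (- 1) * m%:Z + (d + m.-1)%N%:Z.
  by rewrite -[X in _ * X%:Z](prednK m_gt0) PoszD -addn1 PoszD; ring.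
by rewrite gcdzC e gcdzMDl gcdzC; congr Posz; apply/eqP.
Qed.

Lemma eq_expr_progression (k : fieldType) (gam : k) (m d i : nat) :
  m.-primitive_root gam -> (i <= d)%N -> gam ^+ i = gam ^+ d ->
  exists j : nat, i%:Z = d%:Z - j%:Z * m%:Z.
Proof.
move=> gamP le_id /eqP; rewrite (eq_prim_root_expr gamP) eq_sym eqn_mod_dvd //.
case/dvdnP => j e; exists j; rewrite -(subnKC le_id) e PoszD PoszM; ring.
Qed.

Section PolyAction.
Context (k : fieldType) (D : taft_datum k).
Local Notation T := (taft D).
Local Notation H := (taft_hopf D).
Local Notation n := (taft_n D).
Local Notation m := (taft_m D).
Local Notation lam := (taft_lambda D).
Local Notation x := (@taft_x k D).
Local Notation g := (@taft_g k D).
Context (act : H -> {poly k} -> {poly k}) (hact : module_algebra act).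
Context (gam : k) (phi : {poly k}).
Hypotheses (act_gX : act g 'X = gam *: 'X) (act_xX : act x 'X = phi).
Hypotheses (gam_neq1 : gam != 1) (phi_neq0 : phi != 0).
Let hmod := module_algebra_module hact.
Let act_linear r : linear (act r) := act_linearr hmod r.
Let actZ r : forall c p, act r (c *: p) = c *: act r p :=
  linear_at_scale (act_linear r).

Let act_diff : twisted_difference gam phi (act x).
Proof. exact: act_x_difference. Qed.

Let act_comm : forall p, dilate gam (act x p) = lam *: act x (dilate gam p).
Proof. exact: act_gx. Qed.

(** The chain of iterates of x from t stops within m steps, so
    gam lam^j = 1 for some j, and lam^m = 1. *)
Lemma gamma_expm : gam ^+ m = 1.
Proof.
have : iter m (act x) 'X^1 = 0.
  rewrite -(act_exp x m 'X^1 hmod) taft_xm.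
  exact: linear_at0 (act_linearl hmod _).
case/(iter_eq0P gam_neq1 act_diff phi_neq0 (actZ x) act_comm) => j _ e.
have := congr1 (fun z => z ^+ m) e.
rewrite expr1n exprMn [lam ^+ j ^+ m]exprAC.
by rewrite (prim_expr_order (taft_lambda_prim D)) expr1n mulr1 expr1.
Qed.

(** Evaluating g x = lam x g at t shows that phi is an eigenvector of the
    dilation, of eigenvalue lam gam. *)
Lemma supp_exponent i : phi`_i != 0 -> gam ^+ i = lam * gam.
Proof.
apply: weight_coef; have := act_comm 'X.
by rewrite act_xX dilateX actZ scalerA act_xX.
Qed.

Lemma act_basis i j l :
  act (x ^+ i * g ^+ j) 'X^l = gam ^+ (j * l) *: iter i (act x) 'X^l.
Proof.
have -> : act (x ^+ i * g ^+ j) 'X^l = act (x ^+ i) (act (g ^+ j) 'X^l).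
  exact: act_mul hmod _ _ _.
rewrite (act_exp g j _ hmod).
have -> : iter j (act g) 'X^l = gam ^+ (j * l) *: 'X^l.
  rewrite (eq_iter (act_gE hact act_gX)); apply/polyP => e.
  by rewrite coef_iter_dilate coefZ coefXn; case: eqP => [->|_] //; rewrite !mulr0.
by rewrite actZ (act_exp x i _ hmod).
Qed.

Lemma act_span (c : 'M[k]_(m, n)) l :
  act (\sum_i \sum_j c i j *: (x ^+ i * g ^+ j)) 'X^l =
  \sum_i (\sum_j c i j * gam ^+ (j * l)) *: iter i (act x) 'X^l.
Proof.
have hl := act_linearl hmod 'X^l.
rewrite (linear_at_sum hl); apply: eq_bigr => i _.
rewrite (linear_at_sum hl) scaler_suml; apply: eq_bigr => j _.
by rewrite (linear_at_scale hl) act_basis scalerA.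
Qed.

(** * Inner-faithfulness *)

(** If m < n, the Hopf ideal of g^m - 1 is nonzero, but g^m acts as dilation by
    gam^m = 1. *)
Lemma order_eq_of_inner_faithful : inner_faithful act -> m = n.
Proof.
move=> hf; apply/eqP; apply: contraT => /taft_gm_neq1 gm_neq1.
have [] := hf _ (gm_ideal_hopf D).
  by exists (g ^+ m - 1); [exists 1; rewrite mulr1|rewrite subr_eq0].
move=> z [s [hs ->]]; rewrite big_seq big1 ?eqxx // => -[r a] /hs [t /= ->].
have -> : act ((g ^+ m - 1) * t) a = act (g ^+ m - 1) (act t a).
  exact: act_mul hmod _ _ _.
have hl := act_linearl hmod (act t a).
rewrite (linear_at_add hl) -[- 1]scaleN1r (linear_at_scale hl).
rewrite (act_one hmod) (act_exp g m _ hmod) (eq_iter (act_gE hact act_gX)).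
rewrite scaleN1r; apply/eqP; rewrite subr_eq0; apply/eqP/polyP => i.
by rewrite coef_iter_dilate exprM gamma_expm expr1n mul1r.
Qed.

Section Faithful.
Hypotheses (gam_neq0 : gam != 0) (gam_prim : m.-primitive_root gam).
Hypothesis (eq_mn : m = n).

(** The character x |-> 0, g |-> gam^c of T. *)
Definition weight_char c : T -> k := taft_lift (0 : k^o) (gam ^+ c : k^o).

(** The endomorphism x |-> x, g |-> gam^c g of T. *)
Definition weight_shift c : T -> T := taft_lift x (gam ^+ c *: g).

Let gamXn c : gam ^+ c ^+ n = 1.
Proof. by rewrite exprAC -eq_mn gamma_expm expr1n. Qed.

Lemma char_relations c : taft_relations_hold D (0 : k^o) (gam ^+ c : k^o).
Proof.
split; first exact: gamXn.
  by rewrite expr0n gtn_eqF // ltnW ?taft_m_gt1.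
by rewrite mulr0 mul0r scaler0.
Qed.

Lemma shift_relations c : taft_relations_hold D x (gam ^+ c *: g).
Proof.
split; last by rewrite -scalerAl taft_gx scalerA mulrC -scalerA scalerAr.
  by rewrite exprZn gamXn taft_gn scale1r.
exact: taft_xm.
Qed.

(** For 0 < i < m the polynomial x^i(t^c) has eigenvalue gam^c lam^i, different
    from gam^c, so it has no term t^c: the matrix coefficient of t^c sees x as 0.
    Hence the character vanishes on whatever kills k[t]. *)
Lemma weight_charE c r : weight_char c r = (act r 'X^c)`_c.
Proof.
have [h1 hM] := taft_lift_monoid (char_relations c).
have hX s j : weight_char c (s ^+ j) = weight_char c s ^+ j.
  by elim: j => [|j ih]; rewrite ?expr0 // !exprS -ih -hM.
have hlin : linear (weight_char c : T -> k^o) := taft_lift_linear (char_relations c).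
have [a ->] := taft_span r; rewrite act_span.
rewrite (linear_at_sum hlin) coef_sum; apply: eq_bigr => i _.
rewrite (linear_at_sum hlin) coefZ mulr_suml; apply: eq_bigr => j _.
rewrite (linear_at_scale hlin) [weight_char _ _]hM.
rewrite -![taft_lift _ _ _]/(weight_char _ _) !hX.
rewrite [weight_char c x](taft_lift_x (char_relations c)).
rewrite [weight_char c g](taft_lift_g (char_relations c)).
rewrite -mulrA -[_ *: _]/(_ * _) -exprM [(c * j)%N]mulnC; congr (_ * _).
rewrite mulrC; congr (_ * _).
have [i0|i_gt0] := posnP i; first by rewrite i0 expr0 /= coefXn eqxx.
rewrite expr0n gtn_eqF //; apply/esym/eqP; apply: contraT => ne0.
have := weight_coef (iter_weight (actZ x) act_comm c i) ne0.
rewrite -[LHS]mulr1 => /(mulfI (expf_neq0 _ gam_neq0)) /esym /eqP.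
rewrite -(prim_order_dvd (taft_lambda_prim D)) => /(dvdn_leq i_gt0).
by rewrite leqNgt ltn_ord.
Qed.

Lemma weight_char_bilinear c :
  is_bilinear (fun r1 r2 : T => weight_char c r2 *: r1).
Proof.
have hlin := taft_lift_linear (char_relations c).
split=> [v e u u'|u e v v'] /=; first by rewrite scalerDr !scalerA mulrC.
by rewrite /weight_char hlin scalerDl scalerA.
Qed.

(** The convolution id * chi_c is multiplicative, so it is determined on the
    generators: g (x) g gives gam^c g, and g (x) x + x (x) 1 gives x. *)
Lemma weight_shiftE c r :
  tens_elim (fun r1 r2 => weight_char c r2 *: r1) (taft_comul r) =
  weight_shift c r.
Proof.
have [h1 hM] := taft_lift_monoid (char_relations c).
have [h1' hM'] := taft_lift_monoid (shift_relations c).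
have hb := weight_char_bilinear c.
have hl r0 (y : T) : linear (fun t : T => r0 *: (y * t)).
  by move=> e u v; rewrite mulrDr scalerDr -scalerAr !scalerA mulrC.
apply: (taft_tens_ind (f := weight_shift c) hb) _ _ _ _ r => [||r ih|r ih].
- exact: taft_lift_linear (shift_relations c).
- by rewrite [taft_comul 1]rmorph1 tens_elim_pure // [weight_char _ _]h1 scale1r
             [weight_shift _ _]h1'.
- rewrite [taft_comul _]rmorphM /= taft_comul_x mulrDl tens_elimD //.
  rewrite !tens_elimMl // [weight_shift _ _]hM' (taft_lift_x (shift_relations c)).
  rewrite -[X in x * X]ih -(scale1r (x * _)) -(tens_elim_comp _ _ (hl 1 x)).
  rewrite [X in X + _]big1 ?add0r => [|p _].
    by apply: eq_tens_elim => u v; rewrite mul1r scale1r scalerAr.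
  rewrite [weight_char _ _]hM (taft_lift_x (char_relations c)).
  by rewrite mul0r scale0r.
- rewrite [taft_comul _]rmorphM /= taft_comul_g tens_elimMl //.
  rewrite [weight_shift _ _]hM' (taft_lift_g (shift_relations c)).
  rewrite -[X in _ * X]ih -scalerAl -(tens_elim_comp _ _ (hl _ g)).
  apply: eq_tens_elim => u v; rewrite [weight_char _ _]hM.
  by rewrite (taft_lift_g (char_relations c)) -scalerA scalerAr.
Qed.

Lemma weight_shift_basis c i j :
  weight_shift c (x ^+ i * g ^+ j) = gam ^+ (c * j) *: (x ^+ i * g ^+ j).
Proof.
have [h1 hM] := taft_lift_monoid (shift_relations c).
have hX s e : weight_shift c (s ^+ e) = weight_shift c s ^+ e.
  by elim: e => [|e ih]; rewrite ?expr0 // !exprS -ih -hM.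
rewrite [LHS]hM -![taft_lift _ _ _]/(weight_shift _ _) !hX.
rewrite [weight_shift c x](taft_lift_x (shift_relations c)).
rewrite [weight_shift c g](taft_lift_g (shift_relations c)).
by rewrite exprZn -exprM scalerAr.
Qed.

(** comul I lies in I (x) T + T (x) I, and the character kills the second
    summand. *)
Lemma hopf_ideal_shift (I : H -> Prop) c r : hopf_ideal I ->
  (forall r p, I r -> act r p = 0) -> I r -> I (weight_shift c r).
Proof.
move=> hI I0 Ir; have [s1 [s2 [h1 h2 e]]] := hopf_ideal_comul hI Ir.
have hb := weight_char_bilinear c.
rewrite -weight_shiftE -[taft_comul r]/(comul (r : H)) e tens_elimD //.
rewrite !tens_elimE //.
have -> : formal_sum (fun r1 r2 : T => weight_char c r2 *: r1) s2 = 0.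
  rewrite /formal_sum big_seq big1 // => p /h2 Ip.
  by rewrite weight_charE I0 // coef0 scale0r.
rewrite addr0 /formal_sum big_seq; apply: (big_ind I).
- exact: hopf_ideal0 hI.
- move=> u v Iu Iv; rewrite -[u]scale1r; exact: hopf_idealP hI _ _ _ Iu Iv.
- move=> p /h1 Ip; rewrite -[_ *: _]addr0.
  exact: hopf_idealP hI _ _ _ Ip (hopf_ideal0 hI).
Qed.

(** The shifts of r let g be replaced by every gam^c g, which separates the
    coefficients a_ij in j; the eigenvalues of x^i(t^l) separate them in i. *)
Lemma annihilating_hopf_ideal_eq0 (I : H -> Prop) r : hopf_ideal I ->
  (forall r p, I r -> act r p = 0) -> I r -> r = 0.
Proof.
move=> hI I0 Ir; have [a ra] := taft_span r.
have lamP := taft_lambda_prim D; have m_gt0 := prim_order_gt0 lamP.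
have lam_neq0 : lam != 0.
  rewrite -unitfE; apply/unitrPr; exists (lam ^+ m.-1).
  by rewrite -exprS prednK // prim_expr_order.
have [l laml] := prim_rootP gam_prim (prim_expr_order lamP).
(* With gam^l = lam the iterates x^i(t^l) have eigenvalue lam^(i+1), which first
   equals 1 at i = m - 1: this starting exponent gives the longest chain. *)
pose u i := iter i (act x) 'X^l.
have uW i : dilate gam (u i) = (lam ^+ i.+1) *: u i.
  rewrite /u (iter_weight (actZ x) act_comm) -laml -exprS //.
have u_neq0 i : (i < m)%N -> u i != 0.
  move=> lt_im; apply/eqP.
  case/(iter_eq0P gam_neq1 act_diff phi_neq0 (actZ x) act_comm) => j lt_ji.
  rewrite -laml -exprS => /eqP; rewrite -(prim_order_dvd lamP).
  by move=> /(dvdn_leq (ltn0Sn j)); rewrite leqNgt (leq_ltn_trans lt_ji lt_im).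
have rows (c : nat) (i : 'I_m) :
    \sum_j a i j * gam ^+ ((c + l) * j) = 0.
  have := I0 _ 'X^l (hopf_ideal_shift c hI I0 Ir).
  have hl : linear (weight_shift c) := taft_lift_linear (shift_relations c).
  have -> : weight_shift c r = \sum_i \sum_j
      (\matrix_(i, j) (a i j * gam ^+ (c * j))) i j *: (x ^+ i * g ^+ j).
    rewrite ra (linear_at_sum hl); apply: eq_bigr => i' _.
    rewrite (linear_at_sum hl); apply: eq_bigr => j _.
    by rewrite (linear_at_scale hl) mxE -scalerA -weight_shift_basis.
  rewrite act_span => /polyP e.
  (* Reading off a coefficient in the support of u i discards the u i' with
     i' <> i, whose eigenvalues differ. *)
  have [e0 ne0] : exists e0, (u i)`_e0 != 0.
    by exists (size (u i)).-1; rewrite -lead_coefE lead_coef_eq0 u_neq0.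
  have := e e0; rewrite coef0 coef_sum (bigD1 i) //= [X in _ + X]big1 => [|i' ne].
    rewrite addr0 coefZ => /eqP; rewrite mulf_eq0 (negPf ne0) orbF => /eqP z.
    rewrite -[RHS]z; apply: eq_bigr => j _.
    by rewrite mxE -mulrA -exprD mulnDl [(j * l)%N]mulnC.
  rewrite coefZ -/(u i'); have [->|ne1] := eqVneq (u i')`_e0 0; first exact: mulr0.
  have := weight_coef (uW i) ne0; rewrite (weight_coef (uW i') ne1) => /eqP.
  rewrite !exprS (inj_eq (mulfI _)) //.
  rewrite (eq_prim_root_expr lamP) !modn_small //.
  by rewrite val_eqE (negPf ne).
have a0 i j : a i j = 0.
  pose p := \sum_j' a i j' *: 'X^j' : {poly k}.
  have size_p : (size p <= m)%N.
    apply: (leq_trans (size_sum _ _ _)); apply/bigmax_leqP => j' _.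
    by apply: leq_trans (size_scale_leq _ _) _; rewrite size_polyXn eq_mn.
  have p0 : p = 0.
    apply/eqP; apply: contraT => p_neq0.
    have := leq_trans (max_poly_roots (rs := [seq gam ^+ c | c <- iota 0 m])
                         p_neq0 _ _) size_p.
    rewrite size_map size_iota ltnn; apply.
    - apply/allP => _ /mapP[c _ ->]; rewrite rootE horner_sum.
      (* The shift by c + l * m.-1 evaluates at gam^(c + l m) = gam^c. *)
      rewrite -[X in _ == X](rows (c + l * m.-1)%N i); apply/eqP.
      apply: eq_bigr => j' _; rewrite hornerZ hornerXn -exprM; congr (_ * _).
      apply/eqP; rewrite (eq_prim_root_expr gam_prim) -addnA -mulnSr prednK //.
      by rewrite mulnDl mulnAC addnC modnMDl.
    - rewrite map_inj_in_uniq ?iota_uniq // => c c'.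
      rewrite !mem_iota /= !add0n => lt_c lt_c' /eqP.
      by rewrite (eq_prim_root_expr gam_prim) !modn_small // => /eqP.
  have := congr1 (fun q : {poly k} => q`_j) p0.
  rewrite coef0 coef_sum (bigD1 j) //= big1 ?addr0 => [|j' ne].
    by rewrite coefZ coefXn eqxx mulr1.
  by rewrite coefZ coefXn val_eqE eq_sym (negPf ne) mulr0.
by rewrite ra big1 // => i _; rewrite big1 // => j _; rewrite a0 scale0r.
Qed.

Lemma inner_faithful_of_order_eq : inner_faithful act.
Proof.
move=> I hI [r Ir r_neq0]; apply: contrapT => no_z.
have I0 s p : I s -> act s p = 0.
  move=> Is; apply: contrapT => /eqP ne0; apply: no_z; exists (act s p) => //.
  exists [:: (s, p)]; rewrite big_seq1; split=> // q.
  by rewrite inE => /eqP ->.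
by move/eqP: r_neq0; apply; apply: (annihilating_hopf_ideal_eq0 hI I0 Ir).
Qed.

End Faithful.
End PolyAction.

(** * Existence of the structure *)

Section PolyStructure.
Context (k : fieldType) (D : taft_datum k).
Local Notation T := (taft D).
Local Notation H := (taft_hopf D).
Local Notation n := (taft_n D).
Local Notation m := (taft_m D).
Local Notation lam := (taft_lambda D).
Local Notation x := (@taft_x k D).
Local Notation g := (@taft_g k D).
Context (gam : k) (phi : {poly k}).
Hypotheses (gam_neq0 : gam != 0) (gam_neq1 : gam != 1) (phi_neq0 : phi != 0).
Hypotheses (gam_prim : m.-primitive_root gam).
Hypothesis (phi_weight : dilate gam phi = (lam * gam) *: phi).

Let opX : endo {poly k} := Endo (twisted_diff_linear gam_neq1 phi).
Let opG : endo {poly k} := Endo (@dilate_linear k gam).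

(** Since gam has order m as lam does, gam^l is an inverse power of lam; so every
    chain of iterates of x from t^l stops within m steps. *)
Lemma poly_relations : taft_relations_hold D opX opG.
Proof.
have lamP := taft_lambda_prim D.
have comm := dilate_twisted_diff gam_neq1 gam_neq0 phi_weight.
split; apply: endoP => p.
- rewrite endoX; apply/polyP => i; rewrite coef_iter_dilate exprM.
  have /dvdnP[q ->] := taft_m_dvd_n D.
  by rewrite mulnC exprM (prim_expr_order gam_prim) !expr1n mul1r.
- rewrite -[p]coefK poly_def (linear_at_sum (endo_linear _)) big1 // => l _.
  rewrite (linear_at_scale (endo_linear _)) endoX.
  have [j e] := prim_rootP lamP (prim_expr_order gam_prim).
  have [i lt_im ei] : exists2 i, (i < m)%N & gam ^+ l * lam ^+ i = 1.
    (* With gam = lam^j, the exponent -j l is represented by j l (m - 1). *)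
    exists ((j * l * m.-1) %% m)%N; first by rewrite ltn_mod (prim_order_gt0 lamP).
    rewrite e (prim_expr_mod lamP) -exprM -exprD -mulnS prednK ?(prim_order_gt0 lamP) //.
    by rewrite mulnC exprM (prim_expr_order lamP) expr1n.
  have DZ := linear_at_scale (twisted_diff_linear gam_neq1 phi).
  have -> : iter m opX 'X^l = 0; last by rewrite scaler0.
  apply/(iter_eq0P gam_neq1 (twisted_diffP gam_neq1 phi) phi_neq0 DZ comm).
  by exists i.
- exact: comm.
Qed.

Definition poly_act (r : H) : {poly k} -> {poly k} := taft_lift opX opG r.

Lemma poly_act_x : poly_act x =1 twisted_diff gam phi.
Proof. by move=> p; rewrite /poly_act (taft_lift_x poly_relations). Qed.

Lemma poly_act_g : poly_act g =1 dilate gam.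
Proof. by move=> p; rewrite /poly_act (taft_lift_g poly_relations). Qed.

Lemma poly_act_module : is_module poly_act.
Proof.
have [h1 hM] := taft_lift_monoid poly_relations.
split=> [a c r s|r|a|r s a]; rewrite /poly_act.
- by rewrite (taft_lift_linear poly_relations).
- exact: endo_linear.
- by rewrite h1.
- by rewrite hM.
Qed.

(** The product formula for x r follows from the one for r by the skew Leibniz
    rule, and the one for g r by the multiplicativity of the dilation. *)
Lemma poly_act_module_algebra : module_algebra poly_act.
Proof.
have hm := poly_act_module.
have gE (r : T) p : poly_act (g * r) p = dilate gam (poly_act r p).
  by rewrite -poly_act_g -(act_mul hm).
have xE (r : T) p : poly_act (x * r) p = twisted_diff gam phi (poly_act r p).
  by rewrite -poly_act_x -(act_mul hm).
have Dlin := twisted_diff_linear gam_neq1 phi.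
have glin := @dilate_linear k gam.
have act1 (r : T) : poly_act r 1 = taft_counit r *: 1.
  elim/taft_ind: r => [|r ih|r ih|c r s hr hs].
  - by rewrite (act_one hm) rmorph1 scale1r.
  - rewrite xE ih (linear_at_scale Dlin) twisted_diff1 // scaler0.
    by rewrite rmorphM /= taft_counit_x mul0r scale0r.
  - rewrite gE ih (linear_at_scale glin) -polyC1 dilateC.
    by rewrite rmorphM /= taft_counit_g mul1r.
  - by rewrite (act_linearl hm) hr hs linearP scalerDl scalerA.
split=> // r a b.
have hb := act_tens_bilinear a b hm.
apply/esym; move: r.
apply: (taft_tens_ind (f := fun r : T => poly_act r (a * b)) hb) => [||r ih|r ih].
- exact: act_linearl hm _.
- by rewrite [taft_comul 1]rmorph1 tens_elim_pure // !(act_one hm).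
- rewrite [taft_comul _]rmorphM /= taft_comul_x mulrDl tens_elimD //.
  rewrite !tens_elimMl // xE -ih -(tens_elim_comp _ _ Dlin).
  rewrite /tens_elim /formal_sum -big_split; apply: eq_bigr => p _ /=.
  by rewrite mul1r !xE gE twisted_diffM.
- rewrite [taft_comul _]rmorphM /= taft_comul_g tens_elimMl // gE -ih.
  rewrite -(tens_elim_comp _ _ glin); apply: eq_tens_elim => u v.
  by rewrite !gE dilateM.
Qed.

End PolyStructure.

(** * Classification of the structures on k[t] *)

Lemma supp_weight (k : fieldType) (gam lam : k) (phi : {poly k}) (m d : nat) :
  m.-primitive_root gam -> gam ^+ d = lam * gam ->
  (forall i : nat, phi`_i != 0 -> exists j : nat, i%:Z = d%:Z - j%:Z * m%:Z) ->
  dilate gam phi = (lam * gam) *: phi.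
Proof.
move=> gamP gd h; apply/polyP => i; rewrite coef_dilate coefZ -gd.
have [->|/h[j e]] := eqVneq phi`_i 0; first by rewrite !mulr0.
have -> : d = (i + m * j)%N.
  by apply/eqP; rewrite -eqz_nat PoszD PoszM e mulrC subrK.
by rewrite exprD exprM (prim_expr_order gamP) expr1n mulr1.
Qed.

Theorem proposition2p2 (k : fieldType) (char0 : [pchar k] =i pred0)
    (n m : nat) (lambda : k)
    (n_gt0 : (0 < n)%N) (m_gt1 : (1 < m)%N) (m_dvd_n : (m %| n)%N)
    (lambda_prim : m.-primitive_root lambda)
    (gamma : k) (gamma_neq0 : gamma != 0) (gamma_neq1 : gamma != 1)
    (phi : {poly k}) (d : nat) (phi_deg : size phi = d.+1) :
  let T := taft_hopf (TaftDatum n_gt0 m_gt1 m_dvd_n lambda_prim) in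
  let is_structure (act : T -> {poly k} -> {poly k}) :=
    [/\ module_algebra act, act taft_g 'X = gamma *: 'X & act taft_x 'X = phi] in
  let conditions :=
    [/\ m.-primitive_root gamma,
        lambda = gamma ^ (d%:Z - 1) /\ gcdz (d%:Z - 1) m%:Z = 1
      & forall i : nat, phi`_i != 0 ->
          exists j : nat, i%:Z = d%:Z - j%:Z * m%:Z] in
  (forall act, is_structure act ->
     conditions /\ (inner_faithful act <-> m = n)) /\
  (conditions -> exists! act, is_structure act).
Proof.
move=> T is_structure conditions.
pose D := TaftDatum n_gt0 m_gt1 m_dvd_n lambda_prim.
have phi_neq0 : phi != 0 by rewrite -size_poly_eq0 phi_deg.
split=> [act [hact gX xX]|[gamP [lamE _] supp]].
  have gm := gamma_expm hact gX xX gamma_neq1 phi_neq0.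
  have gsupp := supp_exponent hact gX xX.
  have gd : gamma ^+ d = lambda * gamma.
    by apply: gsupp; rewrite -[d]/(d.+1.-1) -phi_deg -lead_coefE lead_coef_eq0.
  have [gamP lamE co] := primitive_root_conditions gamma_neq0 lambda_prim gm gd.
  split; last split=> [hf|eq_mn].
  - split=> // i phi_i; apply: (eq_expr_progression gamP); last by rewrite gsupp.
    by rewrite -ltnS -phi_deg ltnNge; apply: contra phi_i => /leq_sizeP ->.
  - exact: (order_eq_of_inner_faithful (D := D) hact gX xX gamma_neq1 phi_neq0 hf).
  - exact: (inner_faithful_of_order_eq (D := D) hact gX xX gamma_neq1 phi_neq0 gamma_neq0 gamP eq_mn).
have gd : gamma ^+ d = lambda * gamma.
  by rewrite lamE expfzDr // -mulrA exprN1 mulVf // mulr1.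
have hw := supp_weight gamP gd supp.
have hact : module_algebra (@poly_act k D gamma phi gamma_neq1) :=
  @poly_act_module_algebra k D gamma phi gamma_neq0 gamma_neq1 phi_neq0 gamP hw.
have hx := @poly_act_x k D gamma phi gamma_neq0 gamma_neq1 phi_neq0 gamP hw.
have hg := @poly_act_g k D gamma phi gamma_neq0 gamma_neq1 phi_neq0 gamP hw.
exists (@poly_act k D gamma phi gamma_neq1); split.
  split=> //; first by rewrite hg dilateX.
  by rewrite hx twisted_diffX.
move=> act [hact' gX xX]; apply/funext => r; apply/funext.
apply: act_ext (module_algebra_module hact) (module_algebra_module hact') _ _ r.
- apply: (twisted_difference_inj (phi := phi) gamma_neq1) => p.
    by rewrite hx; apply: twisted_diffP.
  exact: (act_x_difference (D := D) hact' gX xX p).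
- by move=> p; rewrite hg (act_gE (D := D) hact' gX).
Qed.
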